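(* For $x\ge 1$ let $$T_{3}(x):=\sum_{\substack{m_{1}m_{2}\leq x \\ m_{1}m_{2}\in N_{3}}}s(m_{1},m_{2}),$$ where the sum is over ordered pairs $(m_1,m_2)$ of positive integers with $m_1m_2\le x$ and $m_1m_2$ a perfect cube. Then there are absolute constants $a_0,a_1,a_2,a_3,a_4$ such that, for every $\varepsilon>0$, $$T_{3}(x)=x^{2/3}\sum_{j=0}^{4}a_{j}\log^{j}x+O(x^{5/8+\varepsilon}),$$ where the implied constant depends at most on $\varepsilon$.
   Context: $\mathbb{Z}_m$ denotes the additive group of residue classes modulo $m$. For positive integers $m_1,m_2$, $s(m_1,m_2)$ denotes the total number of subgroups of the group $\mathbb{Z}_{m_1}\times\mathbb{Z}_{m_2}$. $N_k$ denotes the set of $k$-th powers of natural numbers; here $k=3$. $\varepsilon$ denotes an arbitrarily small positive number. *)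

(* Defs.v *)
From mathcomp Require Import all_boot all_order all_algebra all_fingroup.
From mathcomp Require Import all_classical all_reals all_analysis.

Set Implicit Arguments.
Unset Strict Implicit.
Unset Printing Implicit Defensive.

Import Order.TTheory GRing.Theory Num.Theory.

Local Open Scope ring_scope.

(* [Zp m] is the additive group of residues modulo m for every m > 0: its
   carrier type is ['Z_m], but it is cut down to the trivial group at m = 1,
   where ['Z_1] has two elements. *)
Definition s (m1 m2 : nat) : nat := #|subgroups (finset.setX (Zp m1) (Zp m2))|.

Definition perfect_cube (n : nat) : bool := [exists k : 'I_n.+1, k ^ 3 == n]%N.

(* The bound [Num.truncn x] on each variable only makes the sum finite: it is
   implied by m1 * m2 <= x. *)
Definition T3 (R : realType) (x : R) : R :=
  \sum_(1 <= m1 < (Num.truncn x).+1)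
    \sum_(1 <= m2 < (Num.truncn x).+1 |
          ((m1 * m2)%:R <= x) && perfect_cube (m1 * m2))
      (s m1 m2)%:R.

(* Main.v *)
Require Import Defs.
From mathcomp Require Import all_boot all_order all_algebra all_fingroup.
From mathcomp Require Import all_solvable.
From mathcomp Require Import all_classical all_reals all_analysis.
From mathcomp Require Import ring lra zify.

(** Put y = x^(1/3); then T3 x is the sum over n <= y of
    f n = \sum_(d %| n^3) s(d, n^3/d). Goursat's lemma gives
    s(m1, m2) = \sum_(d %| m1) \sum_(e %| m2) gcd(d, e), so f is multiplicative,
    with f p = 4p + 16 and f (p^2) = p^3 + O(p^2). Hence f = D * h (Dirichlet
    convolution), where D has Dirichlet series zeta(s-1)^4 zeta(2s-3) and h is
    absolutely summable with weight n^(-13/7), by an Euler product bound.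
    The summatory function of D is obtained from those of n and of m^2 |-> m^3 by
    four applications of the hyperbola method: if a and b have summatory functions
    x^2 P(ln x) + O(x^(2-al)) and x^2 Q(ln x) + O(x^(2-be)), cutting at
    m <= x^(be/(al+be)) gives x^2 S(ln x) + O(x^(2-ga)) for a * b with
    size S <= size P + size Q and any ga < al be/(al+be). This yields ga = 1/8
    and size 5 for D, and convolving with h preserves both. *)

Import Order.TTheory GRing.Theory Num.Theory.
Import numFieldNormedType.Exports.

Set Implicit Arguments.
Unset Strict Implicit.
Unset Printing Implicit Defensive.

Local Open Scope ring_scope.

(** * Multiplicative functions and their local power series *)

Section EulerProducts.
Variable K : comNzRingType.
Implicit Types (F G H : nat -> nat -> K) (a b : nat -> K) (p n m k v t : nat).

(** D collects exactly the local terms of order 1/p at s = 2, namely 4p * p^(-2) and p^3 * p^(-4).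
    Each of its five zeta factors has a simple pole there, which is why the logarithms stop at the
    fourth power. The argument is elementary, and no coefficient of a main term is computed: an
    expansion is the existence of a polynomial of bounded size, with coefficients obtained from
    antiderivatives and limits. In the hyperbola method the inner main term contains ln (x / m), so
    sums of a m / m^2 * (ln m)^j are needed with a power saving; partial summation supplies them.
    The hyperbola step assumes nonnegative coefficients, whereas h changes sign, hence a separate
    lemma for absolutely summable factors. A saving of 1/8 in y leaves y^(15/8) = x^(5/8). Since it
    lies strictly below what the hyperbola steps allow, all stray logarithms are absorbed and the
    final constant does not depend on eps. *)

Definition conv a b n : K := \sum_(d <- divisors n) a d * b (n %/ d)%N.

(** A multiplicative function is stored through its values F p v at prime powers, so that identities
    between Dirichlet series can be checked one prime at a time. *)
Definition euler F n : K := \prod_(p <- primes n) F p (logn p n).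

Definition cauchy F G p v : K := \sum_(i < v.+1) F p i * G p (v - i)%N.

Lemma perm_divisors_pfactor p k m : prime p -> coprime p m -> (0 < m)%N ->
  perm_eq (divisors (p ^ k * m))
    [seq (p ^ i * d)%N | i <- index_iota 0 k.+1, d <- divisors m].
Proof.
move=> pr_p copm m0; have p0 := prime_gt0 pr_p.
have n0 : (0 < p ^ k * m)%N by rewrite muln_gt0 expn_gt0 p0.
have logd i d : d \in divisors m -> logn p (p ^ i * d) = i.
  rewrite -dvdn_divisors// => dm.
  rewrite lognM ?expn_gt0 ?p0 ?(dvdn_gt0 m0 dm)// pfactorK//.
  by rewrite logn_coprime ?addn0// (coprime_dvdr dm).
apply: uniq_perm; first exact: divisors_uniq.
  apply: allpairs_uniq; [exact: iota_uniq|exact: divisors_uniq|].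
  move=> [i d] [j e] /allpairsPdep[i' [d' [_ d'm [-> ->]]]].
  move=> /allpairsPdep[j' [e' [_ e'm [-> ->]]]] /= eq_ide.
  have ij : i' = j' by rewrite -(logd i' d')// eq_ide logd.
  move: eq_ide; rewrite ij => /eqP; rewrite eqn_pmul2l ?expn_gt0 ?p0//.
  by move=> /eqP ->.
move=> x; rewrite -dvdn_divisors//; apply/idP/allpairsP => [xn|[[i d] /=]].
  have x0 := dvdn_gt0 n0 xn.
  have [d copd xE] := pfactor_coprime pr_p x0.
  exists (logn p x, d) => /=; rewrite mem_index_iota -dvdn_divisors//.
  split; last by rewrite mulnC.
    rewrite /= ltnS (leq_trans (dvdn_leq_log p n0 xn))// lognM ?expn_gt0 ?p0//.
    by rewrite pfactorK// logn_coprime// addn0.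
  rewrite -(Gauss_dvdr m (n := p ^ k)); last by rewrite coprime_sym coprimeXl.
  by apply: dvdn_trans xn; rewrite [X in (_ %| X)%N]xE dvdn_mulr.
rewrite mem_index_iota -dvdn_divisors// ltnS => -[/= ik dm ->].
by rewrite dvdn_mul// dvdn_exp2l.
Qed.

Lemma perm_primes_pfactor p k m : prime p -> coprime p m -> (0 < m)%N -> (0 < k)%N ->
  perm_eq (primes (p ^ k * m)) (p :: primes m).
Proof.
move=> pr_p copm m0 k0; apply: uniq_perm; first exact: primes_uniq.
  rewrite /= primes_uniq andbT mem_primes pr_p m0 /=.
  by rewrite -prime_coprime.
have p0 := prime_gt0 pr_p.
move=> q; rewrite primesM ?expn_gt0 ?p0// primesX// primes_prime//.
by rewrite !inE.
Qed.

(** Strips the full power of the least prime factor, so that a multiplicative identity only needs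
    its step across coprime factors. *)
Lemma prime_power_ind (P : nat -> Prop) : P 1%N ->
  (forall p k m, prime p -> (0 < k)%N -> coprime p m -> (0 < m)%N -> P m ->
    P (p ^ k * m)%N) ->
  forall n, (0 < n)%N -> P n.
Proof.
move=> P1 Pp n; elim/ltn_ind: n => n IH n0.
have [n1|n1] := leqP n 1; first by rewrite (_ : n = 1%N)//; apply/eqP; rewrite eqn_leq n1.
have pr_p := pdiv_prime n1.
have [m copm nE] := pfactor_coprime pr_p n0.
have k0 : (0 < logn (pdiv n) n)%N by rewrite logn_gt0 mem_primes pr_p n0 pdiv_dvd.
have m0 : (0 < m)%N by move: n0; rewrite nE muln_gt0 => /andP[].
rewrite nE mulnC; apply: Pp => //; apply: IH => //.
rewrite [X in (_ < X)%N]nE -[X in (X < _)%N]muln1 ltn_pmul2l//.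
by rewrite -(expn0 (pdiv n)) ltn_exp2l// prime_gt1.
Qed.

Lemma euler1 F : euler F 1 = 1.
Proof. by rewrite /euler big_nil. Qed.

Lemma euler_pfactor F p k m : F p 0%N = 1 ->
  prime p -> coprime p m -> (0 < m)%N -> euler F (p ^ k * m) = F p k * euler F m.
Proof.
move=> Fp0 pr_p copm m0; have [->|k0] := posnP k.
  by rewrite expn0 mul1n Fp0 mul1r.
have p0 := prime_gt0 pr_p.
rewrite /euler (perm_big _ (perm_primes_pfactor pr_p copm m0 k0)) big_cons.
rewrite lognM ?expn_gt0 ?p0// pfactorK// logn_coprime// addn0; congr (_ * _).
rewrite !big_seq; apply: eq_bigr => q qm.
rewrite lognM ?expn_gt0 ?p0// lognX logn_prime//.
case: eqP qm => [->|_ _]; last by rewrite muln0.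
by rewrite mem_primes => /and3P[_ _]; rewrite (prime_coprime _ pr_p) in copm; rewrite (negPf copm).
Qed.

Lemma euler_exp F k n : (0 < k)%N -> euler F (n ^ k) = euler (fun p v => F p (k * v)%N) n.
Proof.
by move=> k0; rewrite /euler primesX//; apply: eq_bigr => p _; rewrite lognX.
Qed.

Lemma eq_euler F G n : (forall p v, prime p -> F p v = G p v) -> euler F n = euler G n.
Proof.
move=> FG; rewrite /euler !big_seq; apply: eq_bigr => p.
by rewrite mem_primes => /andP[pr_p _]; rewrite FG.
Qed.

(** Both variables are kept in g because the gcd sum is not a function of d times a function of e;
    joint multiplicativity is enough to split the divisors of p^k * m. This serves Dirichlet
    convolutions as well as [cube_sum]. *)
Lemma divisor_sum_euler (g : nat -> nat -> K) (G : nat -> nat -> nat -> K) :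
  g 1%N 1%N = 1 ->
  (forall p i j m n, prime p -> coprime p m -> coprime p n -> (0 < m)%N -> (0 < n)%N ->
    g (p ^ i * m)%N (p ^ j * n)%N = G p i j * g m n) ->
  forall n, (0 < n)%N ->
  \sum_(d <- divisors n) g d (n %/ d)%N =
  euler (fun p v => \sum_(i < v.+1) G p i (v - i)%N) n.
Proof.
move=> g1 gM; apply: prime_power_ind => [|p k m pr_p k0 copm m0 IH].
  by rewrite euler1 big_seq1.
have p0 := prime_gt0 pr_p.
have G0 : G p 0%N 0%N = 1.
  by have := gM p 0 0 1 1%N pr_p; rewrite !coprimen1 !muln1 g1 mulr1 => ->.
rewrite euler_pfactor//; last by rewrite big_ord1.
rewrite (perm_big _ (perm_divisors_pfactor k pr_p copm m0)) big_allpairs_dep /=.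
rewrite big_mkord big_distrl; apply: eq_bigr => i _.
rewrite /= -IH big_distrr /= !big_seq; apply: eq_bigr => d.
rewrite -dvdn_divisors// => dm; have ik : (i <= k)%N by rewrite -ltnS.
have d0 := dvdn_gt0 m0 dm.
have -> : (p ^ k * m %/ (p ^ i * d) = p ^ (k - i) * (m %/ d))%N.
  have -> : (p ^ k * m = p ^ i * (p ^ (k - i) * m))%N by rewrite mulnA -expnD subnKC.
  by rewrite divnMA mulKn ?expn_gt0 ?p0// -muln_divA.
apply: gM => //; first exact: coprime_dvdr dm copm.
  by apply: coprime_dvdr copm; apply: dvdn_div.
by rewrite divn_gt0// dvdn_leq.
Qed.

Lemma conv_euler F G : (forall p, F p 0%N = 1) -> (forall p, G p 0%N = 1) ->
  forall n, (0 < n)%N -> conv (euler F) (euler G) n = euler (cauchy F G) n.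
Proof.
move=> F0 G0; apply: (divisor_sum_euler (g := fun d e => euler F d * euler G e)
  (G := fun p i j => F p i * G p j)).
  by rewrite !euler1 mulr1.
by move=> p i j m n pr_p copm copn m0 n0; rewrite !euler_pfactor// mulrACA.
Qed.

Lemma eq_conv a a' b b' n : (0 < n)%N -> (forall d, (0 < d)%N -> a d = a' d) ->
  (forall d, (0 < d)%N -> b d = b' d) -> conv a b n = conv a' b' n.
Proof.
move=> n0 aa bb; rewrite /conv !big_seq; apply: eq_bigr => d.
rewrite -dvdn_divisors// => dn; have d0 := dvdn_gt0 n0 dn.
by rewrite aa// bb// divn_gt0// dvdn_leq.
Qed.

Lemma cauchy0 F G p : F p 0%N = 1 -> G p 0%N = 1 -> cauchy F G p 0 = 1.
Proof. by move=> F0 G0; rewrite /cauchy big_ord1 F0 G0 mulr1. Qed.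

(** A coefficient of index at most J sees nothing beyond degree J, so commutativity and
    associativity of [cauchy] are inherited from polynomials. *)
Let trunc J F p : {poly K} := \poly_(i < J.+1) F p i.

Let coef_trunc J F p i : (i <= J)%N -> (trunc J F p)`_i = F p i.
Proof. by move=> iJ; rewrite coef_poly ltnS iJ. Qed.

Lemma cauchy_coefM J F G p v : (v <= J)%N ->
  cauchy F G p v = (trunc J F p * trunc J G p)`_v.
Proof.
move=> vJ; rewrite coefM; apply: eq_bigr => i _.
by rewrite !coef_trunc// (leq_trans _ vJ) ?leq_subr// -ltnS.
Qed.

Lemma cauchyC F G : cauchy F G = cauchy G F.
Proof.
by apply/funext => p; apply/funext => v; rewrite !(cauchy_coefM _ _ _ (leqnn v)) mulrC.
Qed.

Lemma cauchyA F G H : cauchy F (cauchy G H) = cauchy (cauchy F G) H.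
Proof.
apply/funext => p; apply/funext => v.
transitivity (trunc v F p * (trunc v G p * trunc v H p))`_v.
  rewrite coefM; apply: eq_bigr => i _.
  have iv : (i <= v)%N by rewrite -ltnS.
  by rewrite coef_trunc// (cauchy_coefM _ _ _ (leq_subr i v)).
rewrite mulrA coefM; apply: eq_bigr => i _.
have iv : (i <= v)%N by rewrite -ltnS.
by rewrite coef_trunc ?leq_subr// (cauchy_coefM _ _ _ iv).
Qed.

(** For t > 0, the coefficients of 1 / (1 - c p * X^t); [linear_factor] gives those of the inverse
    series. *)
Definition geom t (c : nat -> K) p v : K := if (t %| v)%N then c p ^+ (v %/ t) else 0.

Definition linear_factor t (c : nat -> K) p v : K := (v == 0)%:R - c p * (v == t)%:R.

Lemma cauchy_linear_factor t c F p v : cauchy (linear_factor t c) F p v =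
  F p v - (if (t <= v)%N then c p * F p (v - t)%N else 0).
Proof.
have delta (s : nat) (x : nat -> K) :
    \sum_(i < v.+1) (i == s :> nat)%:R * x i = if (s <= v)%N then x s else 0.
  under eq_bigr => i _ do rewrite mulr_natl mulrb.
  rewrite -big_mkcond; case: leqP => sv.
    by rewrite (big_pred1 (Ordinal (sv : s < v.+1)%N))//.
  by rewrite big1// => i /eqP si; have := ltn_ord i; rewrite si ltnS leqNgt sv.
rewrite /cauchy /linear_factor.
under eq_bigr => i _ do rewrite mulrBl -mulrA mulrCA.
rewrite sumrB (delta 0%N (fun i => F p (v - i)%N)).
by rewrite (delta t (fun i => c p * F p (v - i)%N)) leq0n subn0.
Qed.

Lemma geomK t c F : (0 < t)%N -> cauchy (geom t c) (cauchy (linear_factor t c) F) = F.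
Proof.
move=> t0; rewrite cauchyA [cauchy (geom _ _) _]cauchyC.
(* [linear_factor 0 (fun=> 0)] is the series 1, the unit of [cauchy]. *)
have -> : cauchy (linear_factor t c) (geom t c) = linear_factor 0 (fun=> 0).
  apply/funext => p; apply/funext => v.
  rewrite cauchy_linear_factor /linear_factor mul0r subr0 /geom.
  have [->|v0] := posnP v; first by rewrite dvdn0 div0n expr0 leqNgt t0 subr0.
  case: leqP => tv; last first.
    by rewrite ifF ?subr0// gtnNdvd.
  have {v0 tv}[u ->] : exists u, v = (u + t)%N by exists (v - t)%N; rewrite subnK.
  rewrite addnK dvdn_addl// divnDr// divnn t0 addn1.
  by case: ifP => _; rewrite ?mulr0 ?subr0// -exprS subrr.
apply/funext => p; apply/funext => v.
by rewrite cauchy_linear_factor mul0r subr0.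
Qed.

End EulerProducts.

(** * Roots and subgroups in cyclic groups *)

Section CyclicGroups.
Local Open Scope group_scope.
Variable gT : finGroupType.
Implicit Types (B K : {group gT}) (y z : gT).

Lemma mem_cyclic_order B K z : cyclic B -> K \subset B -> z \in B ->
  (z \in K) = (#[z] %| #|K|)%N.
Proof.
move=> cycB sKB Bz; rewrite -cycle_subG orderE.
by rewrite (cardSg_cyclic cycB)// cycle_subG.
Qed.

(** The roots form the subgroup of order gcdn N #|B|: in B, an element is killed by N iff its order
    divides this gcd. *)
Lemma card_cyclic_roots B N : cyclic B ->
  #|[set y in B | y ^+ N == 1]| = gcdn N #|B|.
Proof.
case/cyclicP => b defB; have cycB : cyclic B by rewrite defB cycle_cyclic.
have gB : (gcdn N #|B| %| #[b])%N by rewrite orderE -defB dvdn_gcdr.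
set Z := <[b ^+ (#[b] %/ gcdn N #|B|)]>%G.
have oZ : #|Z| = gcdn N #|B|.
  rewrite /= -orderE orderXdiv ?dvdn_div//.
  rewrite -{1}(divnK gB) mulKn// divn_gt0 ?(dvdn_gt0 _ gB)//.
  by rewrite dvdn_leq.
have sZB : Z \subset B by rewrite defB cycleX.
rewrite -oZ; apply: eq_card => y; rewrite !inE.
have [By|nBy] /= := boolP (y \in B); last first.
  by apply/esym/negbTE; apply: contra nBy => yZ; exact: (fintype.subsetP sZB y yZ).
rewrite (mem_cyclic_order cycB sZB By) oZ -order_dvdn dvdn_gcd.
by rewrite (order_dvdG By) andbT.
Qed.

(** A cyclic group has exactly one subgroup of each order dividing its own. *)
Lemma sum_subgroups_cyclic (F : nat -> nat) B : cyclic B ->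
  (\sum_(H in subgroups B) F #|H| = \sum_(d <- divisors #|B|) F d)%N.
Proof.
case/cyclicP => b defB.
transitivity (\sum_(H in subgroups B) \sum_(d <- divisors #|B| | d == #|H|) F d)%N.
  apply: eq_bigr => H; rewrite inE => sHB.
  rewrite -big_filter (_ : [seq _ <- _ | _] = [:: #|H|]) ?big_seq1//.
  apply: perm_small_eq => //; apply: uniq_perm => //.
    by rewrite filter_uniq// divisors_uniq.
  move=> d; rewrite mem_filter !inE -dvdn_divisors ?cardG_gt0//.
  by case: eqP => // ->; rewrite cardSg.
rewrite (exchange_big_dep xpredT)//= !big_seq; apply: eq_bigr => d.
rewrite -dvdn_divisors ?cardG_gt0// => dB.
rewrite sum_nat_const -[RHS]mul1n; congr (_ * _)%N.
have db : (d %| #[b])%N by rewrite orderE -defB.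
have := cycle_sub_group db => /(congr1 (fun X : {set {group gT}} => #|X|)).
rewrite cards1 => <-; apply: eq_card => H.
by rewrite !inE -defB [_ \in _]/((H \in subgroups B) && (d == #|H|)) inE [d == _]eq_sym.
Qed.

End CyclicGroups.

(** * Goursat count of the subgroups of a product of two cyclic groups *)

Section SubgroupsOfProduct.
Local Open Scope group_scope.
Variables gT1 gT2 : finGroupType.
Implicit Types (A P : {group gT1}) (B K : {group gT2}) (H : {group gT1 * gT2}).

(* A subgroup H with first projection <[a]> and kernel K is determined by any y
   with (a, y) in H, and these y form a coset of K; so the pairs (H, y) are
   counted by the y in B such that y ^+ #[a] lies in K. *)
Lemma card_goursat_fibre A B P K : cyclic A -> cyclic B ->
  P \subset A -> K \subset B ->
  #|[set H in subgroups (finset.setX A B) |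
       (@fst gT1 gT2 @* H == P) && (@pair1g gT1 gT2 @*^-1 H == K)]|
  = gcdn #|P| (#|B| %/ #|K|).
Proof.
move=> cycA cycB sPA sKB.
have [a defP] := cyclicP (cyclicS sPA cycA).
have abB := cyclic_abelian cycB.
set Fib := [set H in _ | _].
have FibP H : H \in Fib -> [/\ H \subset finset.setX A B, @fst gT1 gT2 @* H = P &
    forall y, ((1, y) \in H) = (y \in K)].
  rewrite !inE => /and3P[sH /eqP fH /eqP kH]; split=> // y.
  by rewrite -kH !inE.
have memB H x y : H \in Fib -> (x, y) \in H -> y \in B.
  by move=> /FibP[sH _ _] /(fintype.subsetP sH); rewrite inE => /andP[].
have cosetH H y z : H \in Fib -> (a, y) \in H -> ((a, z) \in H) = (y^-1 * z \in K).
  move=> HF ayH; have [_ _ <-] := FibP _ HF.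
  have -> : (1, y^-1 * z) = (a, y)^-1 * (a, z) :> gT1 * gT2.
    by congr (_, _); rewrite /= mulVg.
  by rewrite groupMl ?groupV.
have exH H : H \in Fib -> exists y, (a, y) \in H.
  move=> /FibP[_ fH _]; have : a \in @fst gT1 gT2 @* H by rewrite fH defP cycle_id.
  by case/morphimP => -[x y] _ xyH /= ->; exists y.
have decH H y x z : H \in Fib -> (a, y) \in H -> (x, z) \in H ->
    exists i k, [/\ k \in K & (x, z) = (a, y) ^+ i * (1, k)].
  move=> HF ayH xzH; have [sH fH kH] := FibP _ HF.
  have : x \in P by rewrite -fH; apply/morphimP; exists (x, z).
  rewrite defP => /cycleP[i xi]; exists i, ((y ^+ i)^-1 * z).
  have e : (1, (y ^+ i)^-1 * z) = ((a, y) ^+ i)^-1 * (x, z) :> gT1 * gT2.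
    rewrite xi; have -> : (a, y) ^+ i = (a ^+ i, y ^+ i) :> gT1 * gT2.
      by elim: i {xi} => // i IH; rewrite !expgS IH.
    by congr (_, _); rewrite /= mulVg.
  split; last by rewrite e mulKVg.
  by rewrite -kH e groupMl ?groupV ?groupX.
have uniqH H H' y : H \in Fib -> H' \in Fib -> (a, y) \in H -> (a, y) \in H' -> H = H'.
  move=> HF HF' yH yH'; apply/group_inj/eqP; rewrite finset.eqEsubset; apply/andP; split.
    apply/fintype.subsetP => -[x z] /(decH _ _ _ _ HF yH)[i [k [kK ->]]].
    by have [_ _ kH] := FibP _ HF'; rewrite groupM ?groupX ?kH.
  apply/fintype.subsetP => -[x z] /(decH _ _ _ _ HF' yH')[i [k [kK ->]]].
  by have [_ _ kH] := FibP _ HF; rewrite groupM ?groupX ?kH.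
(* In the cyclic group B, y ^+ #[a] lies in K iff its order divides #|K|; this turns the condition
   on y into a root count. *)
pose Y := [set y in B | y ^+ (#[a] * #|K|) == 1].
have YE y : (y \in Y) = (y \in B) && (y ^+ #[a] \in K).
  rewrite inE; case: (boolP (y \in B)) => //= By.
  by rewrite (mem_cyclic_order cycB sKB) ?groupX// order_dvdn expgM.
have powE (y : gT2) i : (a, y) ^+ i = (a ^+ i, y ^+ i) :> gT1 * gT2.
  by elim: i => // i IH; rewrite !expgS IH.
have existsH y : y \in Y -> exists2 H, H \in Fib & (a, y) \in H.
  rewrite YE => /andP[By yK].
  (* The group is generated by (a, y) and 1 x K. Its kernel is no larger than K: a ^+ i = 1 forces
     #[a] to divide i, and then y ^+ i lies in K. *)
  set L := (@pair1g gT1 gT2 @* K)%G; set C := <[(a, y)]>%G.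
  have LE : L :=: finset.setX 1 K by exact: morphim_pair1g.
  have sLAB : L \subset finset.setX A B by rewrite LE finset.setXS// sub1G.
  have centL : L \subset 'C(C).
    rewrite cent_cycle; apply/fintype.subsetP => -[x k].
    rewrite LE inE /= => /andP[/set1P -> kK]; apply/cent1P.
    congr (_, _); rewrite /= ?mulg1 ?mul1g//.
    by apply: (centsP abB) => //; exact: (fintype.subsetP sKB).
  have HE : C <*> L = C * L by rewrite cent_joinEr.
  have ayAB : (a, y) \in finset.setX A B.
    by rewrite inE /= By andbT (fintype.subsetP sPA)// defP cycle_id.
  have sH : C * L \subset finset.setX A B.
    by rewrite mul_subG// cycle_subG.
  have fH : @fst gT1 gT2 @* (C * L) = P.
    rewrite morphimMl ?finset.subsetT// LE morphim_fstX morphim_cycle ?inE//=.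
    by rewrite mulg1 defP.
  have kH z : ((1, z) \in C * L) = (z \in K).
    apply/mulsgP/idP => [[_ [x k] /cycleP[i ->]]|zK].
      rewrite LE inE /= => /andP[/set1P -> kK].
      rewrite powE => -[ai ->]; rewrite groupM//.
      move/eqP: ai; rewrite mulg1 eq_sym -order_dvdn => /dvdnP[j ->].
      by rewrite mulnC expgM groupX.
    exists 1 (1, z); rewrite ?group1 ?mul1g//.
    by rewrite LE inE /= zK set11.
  exists (C <*> L)%G; last first.
    by rewrite /= HE; apply/mulsgP; exists (a, y) 1; rewrite ?mulg1 ?cycle_id ?group1.
  rewrite !inE; apply/and3P; split; rewrite /= HE ?fH//.
  by apply/eqP/setP => z; rewrite !inE -kH.
have cardY : #|Y| = (#|Fib| * #|K|)%N.
  transitivity (\sum_(y in Y) \sum_(H in Fib | (a, y) \in (H : {group _})) 1)%N.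
    rewrite -sum1_card; apply: eq_bigr => y /existsH[H HF yH].
    rewrite (big_pred1 H) // => H' /=; apply/andP/eqP => [[HF' yH']|->//].
    exact: uniqH yH' yH.
  rewrite (exchange_big_dep (mem Fib)) /= => [|y H _ /andP[]//].
  rewrite -sum_nat_const; apply: eq_bigr => H HF.
  rewrite sum1_card; have [y ayH] := exH H HF.
  rewrite -(card_lcoset K y); apply: eq_card => z.
  rewrite mem_lcoset -(cosetH H y z HF ayH) [LHS]/((z \in Y) && ((H \in Fib) && ((a, z) \in H))).
  rewrite HF; apply/andb_idl => azH; change (is_true (z \in Y)); rewrite YE (memB H a z)//=.
  have [_ _ <-] := FibP _ HF.
  by have := groupX #[a] azH; rewrite powE expg_order.
apply/eqP; rewrite -(eqn_pmul2r (cardG_gt0 K)) -cardY.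
rewrite /Y card_cyclic_roots// defP -orderE muln_gcdl divnK//.
exact: cardSg.
Qed.

(** Subgroups are sorted by first projection P and kernel K. The fibre count depends only on the
    orders of P and K, which range over the divisors of #|A| and #|B|; passing from #|K| to its
    complementary divisor e makes the formula symmetric. *)
Theorem card_subgroups_setX A B : cyclic A -> cyclic B ->
  #|subgroups (finset.setX A B)| =
  (\sum_(d <- divisors #|A|) \sum_(e <- divisors #|B|) gcdn d e)%N.
Proof.
move=> cycA cycB.
have kerS H : H \subset finset.setX A B -> (@pair1g gT1 gT2 @*^-1 H)%G \in subgroups B.
  move=> sH; rewrite inE; apply/fintype.subsetP => y; rewrite !inE /=.
  by move/(fintype.subsetP sH); rewrite inE => /andP[].
have fstS H : H \subset finset.setX A B -> (@fst gT1 gT2 @* H)%G \in subgroups A.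
  move=> sH; rewrite inE; apply/fintype.subsetP => x /morphimP[[x' y] _ xyH ->].
  by move/(fintype.subsetP sH): xyH; rewrite inE => /andP[].
rewrite -sum1_card.
rewrite (partition_big (fun H => (@fst gT1 gT2 @* H)%G) (mem (subgroups A))) /=; last first.
  by move=> H; rewrite inE; exact: fstS.
rewrite -(sum_subgroups_cyclic (fun d => \sum_(e <- divisors #|B|) gcdn d e)%N cycA).
apply: eq_bigr => P; rewrite inE => sPA.
rewrite (partition_big (fun H => (@pair1g gT1 gT2 @*^-1 H)%G) (mem (subgroups B))) /=; last first.
  by move=> H; rewrite inE => /andP[+ _]; exact: kerS.
transitivity (\sum_(K in subgroups B) gcdn #|P| (#|B| %/ #|K|))%N.
  apply: eq_bigr => K; rewrite inE => sKB.
  rewrite -(card_goursat_fibre cycA cycB sPA sKB) -sum1_card.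
  apply: eq_bigl => H; rewrite !inE -andbA.
  by congr (_ && (_ && _)); rewrite -val_eqE.
rewrite (sum_subgroups_cyclic (fun k => gcdn #|P| (#|B| %/ k)) cycB).
have B0 := cardG_gt0 B.
rewrite -(big_map (fun k => #|B| %/ k)%N xpredT (gcdn #|P|)).
apply: perm_big; apply: uniq_perm; last first.
- move=> e; rewrite -dvdn_divisors//; apply/mapP/idP => [[k]|eB].
    by rewrite -dvdn_divisors// => kB ->; apply: dvdn_div.
  exists (#|B| %/ e)%N; first by rewrite -dvdn_divisors// dvdn_div.
  by rewrite -{1}(divnK eB) mulKn// divn_gt0 ?(dvdn_gt0 _ eB)// dvdn_leq.
- exact: divisors_uniq.
rewrite map_inj_in_uniq ?divisors_uniq// => j k; rewrite -!dvdn_divisors// => jB kB jk.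
apply/eqP; rewrite -(eqn_pmul2l (m := #|B| %/ j)); last first.
  by rewrite divn_gt0 ?(dvdn_gt0 _ jB)// dvdn_leq.
by rewrite divnK// jk divnK.
Qed.

Lemma cyclic_Zp m : cyclic (Zp m).
Proof. by rewrite /Zp; case: ifP => _; rewrite ?cyclic1// Zp_cycle cycle_cyclic. Qed.

End SubgroupsOfProduct.

(** * The sum over a fixed cube and its factorisation *)

Section CubeSum.
Implicit Types (p i j k m n v : nat).

Definition gcd_sum m n := (\sum_(d <- divisors m) \sum_(e <- divisors n) gcdn d e)%N.

(** For p prime, the value of [gcd_sum] at (p^i, p^j). *)
Definition min_sum p i j := (\sum_(a < i.+1) \sum_(b < j.+1) p ^ minn a b)%N.

Lemma gcdn_pfactor p a b d e : prime p -> coprime p d -> coprime p e ->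
  gcdn (p ^ a * d) (p ^ b * e) = (p ^ minn a b * gcdn d e)%N.
Proof.
move=> pr_p cd ce.
wlog ab : a b d e cd ce / (a <= b)%N => [wl|].
  case/orP: (leq_total a b) => [|ba]; first exact: wl.
  by rewrite gcdnC wl// minnC gcdnC.
rewrite (minn_idPl ab) -(subnKC ab) expnD -mulnA -muln_gcdr Gauss_gcdr//.
by rewrite coprime_sym coprimeXl.
Qed.

Lemma gcd_sum_pfactor p i j m n : prime p -> coprime p m -> coprime p n ->
  (0 < m)%N -> (0 < n)%N ->
  gcd_sum (p ^ i * m) (p ^ j * n) = (min_sum p i j * gcd_sum m n)%N.
Proof.
move=> pr_p cm cn m0 n0; rewrite /gcd_sum /min_sum.
rewrite (perm_big _ (perm_divisors_pfactor i pr_p cm m0)) big_allpairs_dep big_mkord /=.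
rewrite big_distrl; apply: eq_bigr => a _ /=.
under eq_bigr => d _ do
  rewrite (perm_big _ (perm_divisors_pfactor j pr_p cn n0)) big_allpairs_dep big_mkord /=.
rewrite exchange_big big_distrl; apply: eq_bigr => b _ /=.
rewrite big_distrr /= !big_seq; apply: eq_bigr => d; rewrite -dvdn_divisors// => dm.
rewrite big_distrr /= !big_seq; apply: eq_bigr => e; rewrite -dvdn_divisors// => en.
by rewrite gcdn_pfactor// ?(coprime_dvdr dm)// (coprime_dvdr en).
Qed.

Lemma s_gcd_sum m n : (0 < m)%N -> (0 < n)%N -> s m n = gcd_sum m n.
Proof.
move=> m0 n0; rewrite /s (card_subgroups_setX (cyclic_Zp m) (cyclic_Zp n)).
by rewrite !card_Zp.
Qed.

Variable K : comNzRingType.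

Definition cube_sum n : K := \sum_(d <- divisors (n ^ 3)) (gcd_sum d (n ^ 3 %/ d))%:R.

Definition cube_local p v : K := \sum_(i < (3 * v).+1) (min_sum p i (3 * v - i))%:R.

Lemma cube_sum_euler n : (0 < n)%N -> cube_sum n = euler cube_local n.
Proof.
move=> n0; rewrite /cube_sum.
rewrite (divisor_sum_euler (g := fun d e => (gcd_sum d e)%:R)
  (G := fun p i j => (min_sum p i j)%:R)) ?expn_gt0 ?n0//.
- by rewrite euler_exp.
- by rewrite /gcd_sum big_seq1 big_seq1.
- by move=> p i j m k pr_p cm ck m0 k0; rewrite gcd_sum_pfactor// natrM.
Qed.

Lemma euler_powers k n : (0 < n)%N ->
  euler (fun p v => p%:R ^+ (k * v) : K) n = n%:R ^+ k.
Proof.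
move: n; apply: prime_power_ind => [|p v m pr_p v0 copm m0 IH].
  by rewrite euler1 expr1n.
by rewrite euler_pfactor ?muln0 ?expr0// IH natrM natrX exprMn -exprM mulnC.
Qed.

Definition id_factor : nat -> nat -> K := geom 1 (fun p => p%:R).

(** Local factors of zeta(2s-3), that is, of the function with value m^3 at m^2 and 0 at
    nonsquares. *)
Definition square_factor : nat -> nat -> K := geom 2 (fun p => p%:R ^+ 3).

Lemma geom0 t (c : nat -> K) p : geom t c p 0 = 1.
Proof. by rewrite /geom dvdn0 div0n. Qed.

Lemma euler_id n : (0 < n)%N -> euler id_factor n = n%:R.
Proof.
move=> n0; rewrite -[RHS]expr1 -(euler_powers 1 n0); apply: eq_euler => p v _.
by rewrite /id_factor /geom dvd1n divn1 mul1n.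
Qed.

Lemma euler_square m : (0 < m)%N -> euler square_factor (m ^ 2) = m%:R ^+ 3.
Proof.
move=> m0; rewrite euler_exp// -(euler_powers 3 m0); apply: eq_euler => p v _.
by rewrite /square_factor /geom dvdn_mulr// mulKn// -exprM.
Qed.

Lemma euler_nonsquare n : (0 < n)%N -> (forall m, n != m ^ 2)%N ->
  euler square_factor n = 0.
Proof.
move=> n0 nsq; suff : euler square_factor n = 0 \/ exists m, n = (m ^ 2)%N.
  by case=> // -[m nm]; have := nsq m; rewrite nm eqxx.
move: n n0 {nsq}; apply: prime_power_ind => [|p v m pr_p v0 copm m0 IH].
  by right; exists 1%N.
rewrite euler_pfactor ?geom0// {1}/square_factor /geom.
case: ifP => [/dvdnP[u vu]|_]; last by left; rewrite mul0r.
case: IH => [->|[m' ->]]; first by left; rewrite mulr0.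
by right; exists (p ^ u * m')%N; rewrite vu expnM expnMn.
Qed.

(* The local series of [cube_sum] times (1 - pX)^4 (1 - p^3 X^2), the inverse of
   the Euler factor of zeta(s-1)^4 zeta(2s-3) at X = p^(-s). *)
Definition residual_local : nat -> nat -> K :=
  let L := cauchy (linear_factor 1 (fun p => p%:R)) in
  L (L (L (L (cauchy (linear_factor 2 (fun p => p%:R ^+ 3)) cube_local)))).

(** The function D, kept as an iterated convolution rather than one Euler product because the
    hyperbola method adds one factor at a time. *)
Definition principal n : K :=
  let nu n := n%:R in
  conv (euler square_factor) (conv nu (conv nu (conv nu nu))) n.

Lemma cube_local0 p : cube_local p 0 = 1.
Proof.
by rewrite /cube_local big_ord1 /min_sum !big_ord1.
Qed.

Lemma linear_factor0 t (c : nat -> K) p : (0 < t)%N -> linear_factor t c p 0 = 1.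
Proof. by move=> t0; rewrite /linear_factor (ltn_eqF t0) mulr0 subr0. Qed.

Lemma residual_local0 p : residual_local p 0 = 1.
Proof.
by do 5![apply: cauchy0; first exact: linear_factor0]; exact: cube_local0.
Qed.

(** All factors are moved to local series. Reassociated to the right, the innermost geometric factor
    meets the outermost linear factor of [residual_local], and [geomK] cancels the five pairs from
    the inside out. *)
Lemma cube_sum_conv n : (0 < n)%N ->
  conv principal (euler residual_local) n = cube_sum n.
Proof.
move=> n0; rewrite cube_sum_euler//.
pose nu n : K := n%:R.
have nuE d : (0 < d)%N -> nu d = euler id_factor d by move=> d0; rewrite euler_id.
have id0 p : id_factor p 0 = 1 by exact: geom0.
have sq0 p : square_factor p 0 = 1 by exact: geom0.
pose F2 := cauchy id_factor id_factor; pose F3 := cauchy id_factor F2.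
pose F4 := cauchy id_factor F3; pose D := cauchy square_factor F4.
have F20 p : F2 p 0%N = 1 by exact: cauchy0.
have F30 p : F3 p 0%N = 1 by exact: cauchy0.
have F40 p : F4 p 0%N = 1 by exact: cauchy0.
have D0 p : D p 0%N = 1 by exact: cauchy0.
have step F a : (forall p, F p 0 = 1) -> (forall d, (0 < d)%N -> a d = euler F d) ->
    forall d, (0 < d)%N -> conv nu a d = euler (cauchy id_factor F) d.
  by move=> F0 aE d d0; rewrite (eq_conv d0 nuE aE) conv_euler.
have E4 := step _ _ F30 (step _ _ F20 (step _ _ id0 nuE)).
have DE d : (0 < d)%N -> principal d = euler D d.
  move=> d0; rewrite /principal.
  rewrite (eq_conv (a' := euler square_factor) (b' := euler F4) d0) ?conv_euler//.
rewrite (eq_conv (a' := euler D) (b' := euler residual_local) n0)// conv_euler//; last first.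
  exact: residual_local0.
congr euler; rewrite /D /F4 /F3 /F2 -!cauchyA /residual_local.
by rewrite /id_factor !geomK.
Qed.

End CubeSum.

(** * Power bounds valid on all of x >= 1 *)

Section BigO.
Variable R : realType.
Implicit Types (P Q G : {poly R}) (f g : R -> R) (th e x : R).

(** Uniform from x = 1 on, not only near infinity: the bounds are inserted under sums at x / m for
    every m up to x. *)
Definition isO f th := exists C, forall x, 1 <= x -> `|f x| <= C * x `^ th.

Lemma powR_expR x th : 0 < x -> x `^ th = expR (th * ln x).
Proof. by move=> x0; rewrite /powR gt_eqF. Qed.

Lemma isO_ge0 f th : isO f th ->
  exists2 C, 0 <= C & forall x, 1 <= x -> `|f x| <= C * x `^ th.
Proof.
move=> [C HC]; exists C => //; have := HC 1 (lexx _).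
by rewrite powR1 mulr1; apply: le_trans.
Qed.

Lemma isO_le f g th th' : th <= th' ->
  (forall x, 1 <= x -> `|f x| <= `|g x|) -> isO g th -> isO f th'.
Proof.
move=> le_th fg /isO_ge0[C C0 HC]; exists C => x x1.
rewrite (le_trans (fg _ x1))// (le_trans (HC _ x1))// ler_wpM2l//.
by rewrite ler_powR.
Qed.

Lemma isO_weak f th th' : th <= th' -> isO f th -> isO f th'.
Proof. by move=> le_th; apply: isO_le. Qed.

Lemma isO_eq f g th : (forall x, 1 <= x -> f x = g x) -> isO g th -> isO f th.
Proof. by move=> fg; apply: isO_le => // x x1; rewrite fg. Qed.

Lemma isO_add f g th : isO f th -> isO g th -> isO (fun x => f x + g x) th.
Proof.
move=> [C HC] [D HD]; exists (C + D) => x x1.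
by rewrite mulrDl (le_trans (ler_normD _ _))// lerD ?HC ?HD.
Qed.

Lemma isO_opp f th : isO f th -> isO (fun x => - f x) th.
Proof. by apply: isO_le => // x _; rewrite normrN. Qed.

Lemma isO_sub f g th : isO f th -> isO g th -> isO (fun x => f x - g x) th.
Proof. by move=> Hf Hg; apply: isO_add => //; exact: isO_opp. Qed.

Lemma isO_mul f g th th' :
  isO f th -> isO g th' -> isO (fun x => f x * g x) (th + th').
Proof.
move=> /isO_ge0[C C0 HC] /isO_ge0[D D0 HD]; exists (C * D) => x x1.
rewrite normrM powRD; last by apply/implyP => _; rewrite gt_eqF// (lt_le_trans _ x1).
by rewrite mulrACA ler_pM ?HC ?HD.
Qed.

Lemma isO_const c : isO (fun=> c) 0.
Proof. by exists `|c| => x x1; rewrite powRr0 mulr1. Qed.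

Lemma isO_pow th : isO (fun x => x `^ th) th.
Proof. by exists 1 => x x1; rewrite mul1r ger0_norm ?powR_ge0. Qed.

Lemma isO_sqr : isO (fun x => x ^+ 2) 2.
Proof.
apply: isO_eq (isO_pow 2) => x x1.
by rewrite -powR_mulrn// (le_trans _ x1).
Qed.

Lemma isO_scale c f th : isO f th -> isO (fun x => c * f x) th.
Proof. by move=> Hf; have := isO_mul (isO_const c) Hf; rewrite add0r. Qed.

Lemma isO_sum n (F : 'I_n -> R -> R) th : (forall i, isO (F i) th) ->
  isO (fun x => \sum_(i < n) F i x) th.
Proof.
move=> /choice[C HC]; exists (\sum_(i < n) C i) => x x1.
rewrite mulr_suml (le_trans (ler_norm_sum _ _ _))// ler_sum// => i _.
exact: HC.
Qed.

Lemma powR_ge1 x u : 1 <= x -> 0 <= u -> 1 <= x `^ u.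
Proof. by move=> x1 u0; rewrite -(powRr0 x) ler_powR. Qed.

Lemma isO_comp u f th :
  0 <= u -> isO f th -> isO (fun x => f (x `^ u)) (u * th).
Proof.
move=> u0 [C HC]; exists C => x x1.
by rewrite powRrM HC ?powR_ge1.
Qed.

(** Stated in w = ln x. Induction on P, splitting e in half: one half bounds the smaller polynomial,
    the other absorbs the factor w through 1 + t <= expR t. *)
Lemma horner_le_expR P (e : R) : 0 < e ->
  exists2 C, 0 <= C & forall w : R, 0 <= w -> `|P.[w]| <= C * expR (e * w).
Proof.
move=> e0; elim/poly_ind: P e e0 => [|P c IH] e e0.
  by exists 0 => // w _; rewrite horner0 normr0 mul0r.
have e2 : 0 < e / 2 by rewrite divr_gt0.
have [C C0 HC] := IH _ e2.
exists (C * (2 / e) + `|c|) => [|w w0].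
  by rewrite addr_ge0// mulr_ge0// divr_ge0// ltW.
rewrite hornerMXaddC (le_trans (ler_normD _ _))// mulrDl lerD//; last first.
  by rewrite ler_peMr// -expR0 ler_expR mulr_ge0// ltW.
rewrite normrM (ger0_norm w0).
have -> : e * w = e / 2 * w + e / 2 * w by field.
have we : w <= 2 / e * expR (e / 2 * w).
  rewrite -ler_pdivrMl ?divr_gt0// invf_div (le_trans _ (expR_ge1Dx _))//.
  by rewrite lerDr.
by rewrite expRD (mulrACA C) ler_pM ?HC.
Qed.

Lemma isO_poly P e : 0 < e -> isO (fun x => P.[ln x]) e.
Proof.
move=> e0; have [C _ HC] := horner_le_expR P e0; exists C => x x1.
by rewrite powR_expR ?HC ?ln_ge0// (lt_le_trans _ x1).
Qed.

End BigO.

(** * Limits with a rate, and calculus in the logarithmic variable *)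

Section Limits.
Variable R : realType.
Implicit Types Q : {poly R}.

(* The limit is the supremum of u - v. *)
Lemma limit_of_oscillation (T : Type) (D : T -> Prop) (u v : T -> R) :
  (exists t, D t) -> (forall s t, D s -> D t -> u s - v s <= u t + v t) ->
  exists L, forall t, D t -> `|u t - L| <= v t.
Proof.
move=> [t0 Dt0] H.
set E := [set y | exists2 s, D s & y = u s - v s]%classic.
have E0 : (E !=set0)%classic by exists (u t0 - v t0); exists t0.
have ubE t : D t -> ubound E (u t + v t) by move=> Dt _ [s Ds ->]; exact: H.
exists (sup E) => t Dt; rewrite ler_distl; apply/andP; split.
  by rewrite lerBlDr; apply: ge_sup => //; exact: ubE.
rewrite -lerBlDr; apply: ub_le_sup; last by exists t.
by exists (u t0 + v t0); exact: ubE.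
Qed.

Lemma lnS_le n : (0 < n)%N -> ln n.+1%:R - ln n%:R <= n%:R^-1 :> R.
Proof.
move=> n0; have n0' : 0 < n%:R :> R by rewrite ltr0n.
rewrite -ln_div ?posrE ?ltr0n// -natr1 mulrDl divff ?gt_eqF// mul1r.
by apply: le_ln1Dx; rewrite (lt_trans _ (y := 0))// ?ltrN10// invr_gt0.
Qed.

Lemma lnS_ge n : (0 < n)%N -> n.+1%:R^-1 <= ln n.+1%:R - ln n%:R :> R.
Proof.
move=> n0; rewrite -opprB -ln_div ?posrE ?ltr0n// lerNr.
have -> : n%:R / n.+1%:R = 1 + - n.+1%:R^-1 :> R.
  by rewrite -natr1; field; rewrite natr1 pnatr_eq0.
by apply: le_ln1Dx; rewrite ltrN2 invf_lt1 ?ltr1n// ltr0n.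
Qed.

(** Makes sums of n^(-1-d) telescope. *)
Lemma powR_diff n (d : R) : (0 < n)%N -> 0 < d ->
  d * n.+1%:R `^ (- 1 - d) <= n%:R `^ (- d) - n.+1%:R `^ (- d).
Proof.
move=> n0 d0; have n0' : 0 < n%:R :> R by rewrite ltr0n.
have -> : n%:R `^ (- d) =
    n.+1%:R `^ (- d) * expR (d * (ln n.+1%:R - ln n%:R)) :> R.
  by rewrite !powR_expR ?ltr0n// -expRD; congr expR; ring.
rewrite powRD; last by rewrite pnatr_eq0 implybT.
rewrite powR_inv1 ?ler0n// mulrA -[X in _ - X]mulr1 -mulrBr mulrC ler_wpM2l ?powR_ge0//.
rewrite lerBrDl (le_trans _ (expR_ge1Dx _))// lerD2l ler_wpM2l ?lnS_ge//.
exact: ltW.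
Qed.

Lemma powR_half (x y e : R) : 0 < y -> y <= 2 * x -> 0 <= e ->
  x `^ (- e) <= 2 `^ e * y `^ (- e).
Proof.
move=> y0 yx e0; have x0 : 0 < x by lra.
rewrite !powRN -ler_pdivrMr ?invr_gt0 ?powR_gt0// invrK ler_pdivrMl ?powR_gt0//.
by rewrite mulrC -powRM ?(ltW x0)// ge0_ler_powR ?nnegrE ?mulr_ge0 ?(ltW x0) ?(ltW y0).
Qed.

Lemma convergent_of_increments (u : nat -> R) (C d : R) : 0 < d ->
  (forall n, (0 < n)%N -> `|u n.+1 - u n| <= C * n%:R `^ (- 1 - d)) ->
  exists L D, forall n, (0 < n)%N -> `|u n - L| <= D * n%:R `^ (- d).
Proof.
move=> d0 H.
have C0 : 0 <= C.
  by have := H 1%N isT; rewrite powR1 mulr1; apply: le_trans.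
(* 1/d comes from [powR_diff], and 2^(1+d) from replacing n by n + 1 <= 2n in the increment bound;
   then the increments of u are dominated by the decrements of D * n^(-d). *)
pose D := C * 2 `^ (1 + d) / d.
have D0 : 0 <= D by rewrite divr_ge0 ?mulr_ge0 ?powR_ge0// ltW.
pose v n := D * n%:R `^ (- d) : R.
have v0 n : 0 <= v n by rewrite mulr_ge0 ?powR_ge0.
have step n : (0 < n)%N -> `|u n.+1 - u n| <= v n - v n.+1.
  move=> n0; rewrite (le_trans (H _ n0))// -mulrBr.
  rewrite (le_trans _ (ler_wpM2l D0 (powR_diff n0 d0)))//.
  rewrite /D !mulrA divfK ?gt_eqF// -mulrA ler_wpM2l//.
  rewrite -opprD powR_half ?ltr0n ?addr_ge0 ?(ltW d0)//.
  by rewrite -natrM ler_nat mul2n -addnn -addn1 leq_add2l.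
have mono m k : (0 < m)%N -> `|u (m + k)%N - u m| <= v m - v (m + k)%N.
  move=> m0; elim: k => [|k IH]; first by rewrite addn0 !subrr normr0.
  rewrite addnS -(subrKA (u (m + k)%N)) (le_trans (ler_normD _ _))//.
  have := step (m + k)%N; rewrite addn_gt0 m0 => /(_ isT); lra.
have [|s t s0 t0|L HL] := @limit_of_oscillation nat (fun n => (0 < n)%N) u v.
- by exists 1%N.
- rewrite lerBlDr; case: (leqP s t) => [st|/ltnW ts].
    have := mono s (t - s)%N s0; rewrite subnKC// ler_distl => /andP[h1 _].
    have := v0 t; have := v0 s; lra.
  have := mono t (s - t)%N t0; rewrite subnKC// ler_distl => /andP[_ h1].
  have := v0 t; have := v0 s; lra.
by exists L, D.
Qed.

Lemma primitive_poly Q : exists2 G : {poly R}, G^`() = Q & (size G <= (size Q).+1)%N.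
Proof.
exists (\poly_(i < (size Q).+1) (Q`_i.-1 / i%:R)); last exact: size_poly.
apply/polyP => i; rewrite coef_deriv coef_poly ltnS.
case: ltnP => [iQ|/(nth_default 0) ->]; last by rewrite mul0rn.
by rewrite /= -[LHS]mulr_natr divfK// pnatr_eq0.
Qed.

(** Mean value theorem: the derivative is (Q' - k Q)(w) e^(-kw), and moving the intermediate point
    back to w changes the exponential by a bounded factor since w' <= w + 1. *)
Lemma expR_poly_lipschitz Q (k e : R) : 0 < e -> exists2 C, 0 <= C &
  forall w w' : R, 0 <= w -> w <= w' -> w' <= w + 1 ->
  `|Q.[w'] * expR (- k * w') - Q.[w] * expR (- k * w)|
    <= C * (w' - w) * expR ((e - k) * w).
Proof.
move=> e0; have [C C0 HC] := horner_le_expR (Q^`() - k *: Q) e0.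
exists (C * expR `|e - k|) => [|w w' w0 ww' w'w]; first by rewrite mulr_ge0 ?expR_ge0.
pose f x : R := Q.[x] * expR (- k * x).
have df (x : R) : is_derive x 1 f ((Q^`() - k *: Q).[x] * expR (- k * x)).
  rewrite /f; apply: is_derive_eq.
  by rewrite !hornerE /GRing.scale /=; ring.
have [|c] := @MVT_segment R f _ w w' ww' (fun x _ => df x).
  apply: continuous_subspaceT => x; apply: differentiable_continuous.
  by apply/derivable1_diffP; have [] := df x.
rewrite in_itv /= => /andP[wc cw'] ->.
rewrite normrM (ger0_norm (x := w' - w)) ?subr_ge0//.
rewrite [leRHS]mulrAC ler_wpM2r ?subr_ge0// normrM (ger0_norm (expR_ge0 _)).
have c0 : 0 <= c by exact: le_trans wc.
rewrite (le_trans (ler_wpM2r (expR_ge0 _) (HC _ c0)))// -!mulrA ler_wpM2l//.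
rewrite -!expRD ler_expR -mulrDl -[e + - k]/(e - k).
rewrite -lerBlDr -mulrBr (le_trans (ler_norm _))// normrM (ger0_norm (x := c - w)) ?subr_ge0//.
by rewrite ler_piMr// lerBlDl (le_trans cw').
Qed.

End Limits.

(** * Summatory functions and partial summation *)

Section PartialSummation.
Variable R : realType.
Implicit Types (P Q G : {poly R}) (a b : nat -> R) (x : R).

Definition summatory a x := \sum_(1 <= n < (Num.truncn x).+1) a n.

(** Trades a range depending on x for a condition inside a fixed range, so that sums can be
    exchanged and compared termwise. *)
Lemma summatoryE X a x : 0 <= x -> (Num.truncn x <= X)%N ->
  summatory a x = \sum_(1 <= n < X.+1 | n%:R <= x) a n.
Proof.
move=> x0 xX; rewrite /summatory (big_nat_widen _ _ X.+1)//.
by apply: eq_bigl => n; rewrite ltnS truncn_ge_nat.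
Qed.

Lemma summatoryS a n : summatory a n.+1%:R = summatory a n%:R + a n.+1.
Proof. by rewrite /summatory !natrK big_nat_recr. Qed.

Lemma size_twice_deriv P : (size (2 *: P + P^`())%R <= size P)%N.
Proof.
rewrite (leq_trans (size_polyD _ _))// geq_max (leq_trans (size_scale_leq _ _))//.
have [->|P0] := eqVneq P 0; first by rewrite deriv0 size_poly0.
by rewrite ltnW// lt_size_deriv.
Qed.

(** Abel summation, one n at a time, in the variable w = ln x. The density of x^2 P(ln x) is e^(2w)
    (2 P + P')(w); against the weight w^j e^(-2w) it leaves (2 P + P') w^j, whose primitive is the
    main part. The constant of integration is the limit L. *)
Lemma partial_summation a P (al de : R) j : 0 < de -> de < al -> al <= 1 ->
  isO (fun x => summatory a x - x ^+ 2 * P.[ln x]) (2 - al) ->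
  exists2 G : {poly R}, (size G <= size P + j.+1)%N &
    isO (fun x => summatory (fun m => a m / m%:R ^+ 2 * ln m%:R ^+ j) x - G.[ln x])
        (- de).
Proof.
move=> de0 deal al1 /isO_ge0[CE CE0 HE].
(* At most two factors n^e are lost to logarithms. With [al <= 1] the mean value errors, of order
   n^(2e-2), stay below n^(-1-de). *)
pose e := (al - de) / 2.
have e0 : 0 < e by rewrite divr_gt0// subr_gt0.
have eE : al = de + 2 * e by rewrite /e; field.
clearbody e.
have [C1 C10 H1] := expR_poly_lipschitz 'X^j 2 e0.
pose Q0 := 2 *: P + P^`().
have [C2 C20 H2] := horner_le_expR Q0 e0.
have [G0 dG0 sG0] := primitive_poly (Q0 * 'X^j).
have [C3 C30 H3] := expR_poly_lipschitz G0 0 e0.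
have [C4 C40 H4] := horner_le_expR 'X^j e0.
pose F w : R := ('X^j).[w] * expR (- 2 * w).
pose N (n : nat) : R := n%:R.
pose E n := summatory a (N n) - N n ^+ 2 * P.[ln (N n)].
have N1 n : (0 < n)%N -> 1 <= N n by move=> n0; rewrite ler1n.
have N0 n : (0 < n)%N -> 0 < N n by move=> n0; rewrite ltr0n.
have expN n c : (0 < n)%N -> expR (c * ln (N n)) = N n `^ c.
  by move=> n0; rewrite powR_expR// N0.
have sqN n : (0 < n)%N -> expR (2 * ln (N n)) = N n ^+ 2.
  by move=> n0; rewrite expRM_natl lnK ?posrE ?N0.
have FN n : (0 < n)%N -> F (ln (N n)) = ln (N n) ^+ j / N n ^+ 2.
  by move=> n0; rewrite /F hornerXn mulNr expRN sqN.
pose phi n := F (ln (N n)).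
pose A := summatory (fun m => a m / m%:R ^+ 2 * ln m%:R ^+ j).
have AS n : A (N n.+1) = A (N n) + a n.+1 * phi n.+1.
  by rewrite /A /N summatoryS /phi FN// mulrA [_ / _ * _]mulrAC.
(* The weighted sum without its boundary term and its predicted main term; what is left
   converges. *)
pose u n := A (N n) - E n * phi n - G0.[ln (N n)].
have lnN n : (0 < n)%N -> 0 <= ln (N n) by move=> n0; rewrite ln_ge0 ?N1.
have lnle n : (0 < n)%N -> ln (N n) <= ln (N n.+1).
  by move=> n0; rewrite ler_ln ?posrE ?N0// ler_nat.
have lnS n : (0 < n)%N -> ln (N n.+1) - ln (N n) <= N n `^ (- 1).
  by move=> n0; rewrite powR_inv1 ?(ltW (N0 _ n0))// lnS_le.
have N_1 n : (0 < n)%N -> N n `^ (- 1) <= 1.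
  by move=> n0; rewrite -[leRHS](powRr0 (N n)) ler_powR ?N1 ?lerN10.
have Npow n c d : (0 < n)%N -> c <= d -> N n `^ c <= N n `^ d.
  by move=> n0 cd; rewrite ler_powR ?N1.
have NM n c d : (0 < n)%N -> N n `^ c * N n `^ d = N n `^ (c + d).
  by move=> n0; rewrite powRD//; apply/implyP => _; rewrite gt_eqF ?N0.
have dphi n : (0 < n)%N -> `|phi n.+1 - phi n| <= C1 * N n `^ (- 1) * N n `^ (e - 2).
  move=> n0; rewrite -(expN n (e - 2))// (le_trans (H1 _ _ (lnN _ n0) (lnle _ n0) _))//.
    by have := lnS _ n0; have := N_1 _ n0; lra.
  by rewrite ler_wpM2r ?expR_ge0// ler_wpM2l ?lnS.
(* The weight is frozen at [phi n.+1], so the derivative of [K n] carries the factor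
   [phi n.+1 - F w], which is small for w between ln n and ln (n+1). *)
pose K n w : R := P.[w] * expR (2 * w) * phi n.+1 - G0.[w].
have uS n : (0 < n)%N -> u n.+1 - u n =
    (K n (ln (N n.+1)) - K n (ln (N n))) - E n * (phi n.+1 - phi n).
  move=> n0; rewrite /u /K !sqN// AS /E {1}/N summatoryS -/(N _).
  by rewrite -/(N n.+1); ring.
have dK n : (0 < n)%N -> `|K n (ln (N n.+1)) - K n (ln (N n))| <=
    C2 * C1 * expR (2 * e) * N n `^ (2 * e - 2).
  move=> n0.
  have dfK (w : R) : is_derive w 1 (K n)
      (Q0.[w] * expR (2 * w) * (phi n.+1 - F w)).
    rewrite /K; apply: is_derive_eq.
    rewrite dG0 /F /Q0 !(hornerE, hornerXn) /GRing.scale /= mulNr expRN.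
    by field; rewrite expR_eq0.
  have [|c] := @MVT_segment R (K n) _ _ _ (lnle _ n0) (fun w _ => dfK w).
    apply: continuous_subspaceT => w; apply: differentiable_continuous.
    by apply/derivable1_diffP; have [] := dfK w.
  rewrite in_itv /= => /andP[wc cw] ->.
  have c0 : 0 <= c := le_trans (lnN _ n0) wc.
  have hS := lnS _ n0; have hS1 := N_1 _ n0.
  rewrite normrM (ger0_norm (x := ln _ - _)) ?subr_ge0 ?lnle//.
  have cw1 : ln (N n.+1) <= c + 1 by lra.
  rewrite !normrM (ger0_norm (expR_ge0 _)).
  have h : expR (2 * c) * `|phi n.+1 - F c| <= C1 * N n `^ (- 1) * expR (e * c).
    rewrite mulrC (le_trans (ler_wpM2r (expR_ge0 _) (H1 _ _ c0 cw cw1)))//.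
    rewrite -!mulrA -expRD -mulrDl subrK ler_wpM2l// ler_wpM2r ?expR_ge0//.
    by rewrite (le_trans _ hS)// lerD2l lerN2.
  rewrite -(mulrA `|Q0.[c]|).
  have h2 := ler_pM (normr_ge0 _) (mulr_ge0 (expR_ge0 _) (normr_ge0 _)) (H2 _ c0) h.
  have lnp : 0 <= ln (N n.+1) - ln (N n) by rewrite subr_ge0 lnle.
  have h3 := ler_pM (mulr_ge0 (normr_ge0 _) (mulr_ge0 (expR_ge0 _) (normr_ge0 _)))
    lnp h2 hS.
  apply: (le_trans h3).
  have -> : C2 * expR (e * c) * (C1 * N n `^ (- 1) * expR (e * c)) * N n `^ (- 1)
    = C2 * C1 * ((expR (e * c) * expR (e * c)) * (N n `^ (- 1) * N n `^ (- 1))) by ring.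
  rewrite -!(mulrA (C2 * C1)) ler_wpM2l ?mulr_ge0// NM// -expRD.
  have -> : N n `^ (2 * e - 2) = N n `^ (2 * e) * N n `^ (- 1 - 1).
    by rewrite NM// -opprD.
  rewrite mulrA ler_wpM2r ?powR_ge0// -expN// -expRD ler_expR.
  have : 0 <= e * (1 + ln (N n) - c) by rewrite mulr_ge0 ?(ltW e0)//; lra.
  lra.
have [L [D HD]] : exists L D, forall n, (0 < n)%N -> `|u n - L| <= D * N n `^ (- de).
  apply: (convergent_of_increments (C := C2 * C1 * expR (2 * e) + CE * C1)) => // n n0.
  rewrite uS// (le_trans (ler_normB _ _))// [leRHS]mulrDl lerD//.
    rewrite (le_trans (dK _ n0))// ler_wpM2l ?mulr_ge0 ?expR_ge0// Npow//.
    lra.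
  rewrite normrM (le_trans (ler_pM _ _ (HE _ (N1 _ n0)) (dphi _ n0)))//.
  have -> : CE * N n `^ (2 - al) * (C1 * N n `^ (- 1) * N n `^ (e - 2))
    = CE * C1 * (N n `^ (2 - al) * N n `^ (- 1) * N n `^ (e - 2)) by ring.
  rewrite ler_wpM2l ?mulr_ge0// !NM// Npow//; lra.
exists (G0 + L%:P).
  rewrite (leq_trans (size_polyD _ _))// geq_max (leq_trans sG0)/=; last first.
    rewrite addnS ltnS (leq_trans (size_polyMleq _ _))// size_polyXn addnS /=.
    by rewrite leq_add2r size_twice_deriv.
  by rewrite addnS (leq_trans (size_polyC_leq1 _)).
have D0 : 0 <= D by have := HD 1%N isT; rewrite powR1 mulr1; apply: le_trans.
(* The factor 2^de pays for returning from n = truncn x to x, as x < n + 1 <= 2n. *)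
exists ((D + CE * C4 + C3) * 2 `^ de) => x x1.
pose n := Num.truncn x.
have n0 : (0 < n)%N by rewrite truncn_gt0.
have xge : N n <= x by rewrite truncn_le (le_trans _ x1).
have xlt : x < N n.+1 by exact: truncnS_gt.
have x0 : 0 < x by exact: lt_le_trans x1.
have lnx : ln (N n) <= ln x by rewrite ler_ln ?posrE ?N0.
have lnx' : ln x <= ln (N n.+1) by rewrite ler_ln ?posrE ?N0// ltW.
have hS := lnS _ n0; have hS1 := N_1 _ n0.
have -> : summatory (fun m => a m / m%:R ^+ 2 * ln m%:R ^+ j) x = A (N n).
  by rewrite /A /summatory /N natrK.
have -> : A (N n) - (G0 + L%:P).[ln x] = (u n - L) + E n * phi n
    - (G0.[ln x] - G0.[ln (N n)]).
  by rewrite hornerD hornerC /u; ring.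
rewrite -(mulrA (D + _ + _)).
apply: (@le_trans _ _ ((D + CE * C4 + C3) * N n `^ (- de))); last first.
  rewrite ler_wpM2l ?addr_ge0 ?mulr_ge0// powR_half// ?ltW//.
  rewrite (lt_le_trans xlt)// /N -natrM ler_nat mul2n -addnn -addn1.
  by rewrite leq_add2l.
rewrite (le_trans (ler_normB _ _))// [leRHS]mulrDl lerD//.
  rewrite (le_trans (ler_normD _ _))// [leRHS]mulrDl lerD ?HD//.
  rewrite normrM (le_trans (ler_pM (normr_ge0 _) (normr_ge0 _) (HE _ (N1 _ n0))
    (y2 := C4 * N n `^ e * N n `^ (- 2)) _))//.
    rewrite /phi /F normrM (ger0_norm (expR_ge0 _)) !expN// ler_wpM2r ?powR_ge0//.
    by rewrite -expN// H4 ?lnN.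
  have -> : CE * N n `^ (2 - al) * (C4 * N n `^ e * N n `^ (- 2))
    = CE * C4 * (N n `^ (2 - al) * N n `^ e * N n `^ (- 2)) by ring.
  rewrite ler_wpM2l ?mulr_ge0// !NM// Npow//; lra.
have := H3 _ _ (lnN _ n0) lnx; rewrite !oppr0 !mul0r !expR0 !mulr1 addr0 => h.
rewrite (le_trans (h _))//; first lra.
rewrite expN// -mulrA ler_wpM2l//.
apply: (@le_trans _ _ (N n `^ (- 1) * N n `^ e)).
  by rewrite ler_wpM2r ?powR_ge0//; lra.
by rewrite NM// Npow//; lra.
Qed.

End PartialSummation.

(** * The hyperbola identity *)

Section Hyperbola.
Variable R : realType.
Implicit Types (P Q G : {poly R}) (a b : nat -> R) (x u : R).

Lemma divisor_sumE X (g : nat -> nat -> R) k : (0 < k <= X)%N ->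
  \sum_(d <- divisors k) g d (k %/ d)%N =
  \sum_(1 <= m < X.+1) \sum_(1 <= n < X.+1 | (m * n == k)%N) g m n.
Proof.
move=> /andP[k0 kX].
have dX d : d \in divisors k -> (d <= X)%N.
  by rewrite -dvdn_divisors// => /(dvdn_leq k0)/leq_trans; apply.
have -> : \sum_(d <- divisors k) g d (k %/ d)%N =
    \sum_(m <- index_iota 1 X.+1 | (m %| k)%N) g m (k %/ m)%N.
  rewrite -[RHS]big_filter; apply: perm_big; apply: uniq_perm.
  - exact: divisors_uniq.
  - by rewrite filter_uniq// iota_uniq.
  move=> d; rewrite mem_filter mem_index_iota -dvdn_divisors// ltnS.
  case: (boolP (d %| k)%N) => //= dk; rewrite (dvdn_gt0 k0 dk) dX//.
  by rewrite -dvdn_divisors.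
rewrite big_mkcond [LHS]big_nat [RHS]big_nat; apply: eq_bigr => m /andP[m1 mX].
case: ifP => mk.
  rewrite (eq_bigl (fun n => n == k %/ m)%N) => [|n].
    rewrite big_nat1_eq ifT// divn_gt0// dvdn_leq// ltnS.
    by rewrite (leq_trans (leq_div _ _)).
  by rewrite eqn_div// mulnC.
by rewrite big1 // => n /eqP mnk; rewrite -mnk dvdn_mulr in mk.
Qed.

Lemma summatory_conv X a b x : 0 <= x -> (Num.truncn x <= X)%N ->
  summatory (conv a b) x =
  \sum_(1 <= m < X.+1) \sum_(1 <= n < X.+1 | (m * n)%:R <= x) a m * b n.
Proof.
move=> x0 xX; rewrite (summatoryE _ x0 xX).
under eq_big_nat do rewrite big_mkcond.
rewrite big_mkcond.
transitivity (\sum_(1 <= k < X.+1) \sum_(1 <= m < X.+1) \sum_(1 <= n < X.+1)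
   if (k%:R <= x) && (k == m * n)%N then a m * b n else 0).
  rewrite big_nat [RHS]big_nat; apply: eq_bigr => k kX.
  rewrite /conv (divisor_sumE (X := X) (fun m n => a m * b n))//; case: ifP => kx.
    apply: eq_bigr => m _; rewrite big_mkcond; apply: eq_bigr => n _.
    by rewrite eq_sym.
  by rewrite big1// => m _; rewrite big1.
rewrite exchange_big; apply: eq_big_nat => m /andP[m0 _].
rewrite exchange_big [RHS]big_mkcond; apply: eq_big_nat => n /andP[n0 _].
rewrite -big_mkcond (big_nat1_cond_eq _ _ (fun k => k%:R <= x)) muln_gt0 m0 n0 /=.
case: (boolP ((m * n)%:R <= x)) => mnx; last by rewrite andbF.
by rewrite andbT ifT// ltnS (leq_trans _ xX)// truncn_ge_nat.
Qed.

(** Since M * N = x, a pair with m * n <= x has m <= M or n <= N, and every pair with both satisfies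
    m * n <= x; the product term removes those counted twice. *)
Lemma hyperbola a b x M N : 1 <= M -> 1 <= N -> M * N = x ->
  summatory (conv a b) x =
    \sum_(1 <= m < (Num.truncn M).+1) a m * summatory b (x / m%:R)
    + \sum_(1 <= n < (Num.truncn N).+1) b n * summatory a (x / n%:R)
    - summatory a M * summatory b N.
Proof.
move=> M1 N1 MNx.
have M0 : 0 <= M by apply: le_trans M1.
have N0 : 0 <= N by apply: le_trans N1.
have x0 : 0 <= x by rewrite -MNx mulr_ge0.
pose X := Num.truncn x.
have MX : (Num.truncn M <= X)%N by rewrite le_truncn// -MNx ler_peMr.
have NX : (Num.truncn N <= X)%N by rewrite le_truncn// -MNx ler_peMl.
have xX n : (0 < n)%N -> (Num.truncn (x / n%:R) <= X)%N.
  by move=> n0; rewrite le_truncn// ler_pdivrMr ?ltr0n// ler_peMr// ler1n.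
have sub c (K : R) : 0 <= K -> (Num.truncn K <= X)%N ->
    \sum_(1 <= m < (Num.truncn K).+1) c m = \sum_(1 <= m < X.+1 | m%:R <= K) c m :> R.
  by move=> K0 KX; rewrite -(summatoryE _ K0 KX).
rewrite (summatory_conv _ _ x0 (leqnn _)) -/X (summatoryE _ M0 MX) (summatoryE _ N0 NX).
rewrite (sub _ _ M0 MX) (sub _ _ N0 NX).
pose S (p : nat -> nat -> bool) : R :=
  \sum_(1 <= m < X.+1) \sum_(1 <= n < X.+1) (if p m n then a m * b n else 0).
have -> : \sum_(1 <= m < X.+1 | m%:R <= M) a m * summatory b (x / m%:R)
    = S (fun m n => (m%:R <= M) && ((m * n)%:R <= x)).
  rewrite big_mkcond; apply: eq_big_nat => m /andP[m0 _].
  case: ifP => mM; last by rewrite big1.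
  rewrite (summatoryE _ _ (xX _ m0)) ?divr_ge0//= big_mkcond mulr_sumr.
  apply: eq_bigr => n _; rewrite ler_pdivlMr ?ltr0n// -natrM mulnC.
  by case: ifP; rewrite ?mulr0.
have -> : \sum_(1 <= n < X.+1 | n%:R <= N) b n * summatory a (x / n%:R)
    = S (fun m n => (n%:R <= N) && ((m * n)%:R <= x)).
  rewrite /S exchange_big big_mkcond; apply: eq_big_nat => m /andP[m0 _].
  case: ifP => mM; last by rewrite big1.
  rewrite (summatoryE _ _ (xX _ m0)) ?divr_ge0//= big_mkcond mulr_sumr.
  apply: eq_bigr => n _; rewrite ler_pdivlMr ?ltr0n// -natrM.
  by case: ifP; rewrite ?mulr0// mulrC.
have -> : (\sum_(1 <= m < X.+1 | m%:R <= M) a m) * (\sum_(1 <= n < X.+1 | n%:R <= N) b n)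
    = S (fun m n => (m%:R <= M) && (n%:R <= N)).
  rewrite !(big_mkcond (fun n : nat => n%:R <= _)) /= big_distrlr; apply: eq_bigr => m _.
  apply: eq_bigr => n _.
  by case: ifP; case: ifP; rewrite /= ?mulr0 ?mul0r.
rewrite /S -big_split -sumrB; apply: eq_big_nat => m /andP[m0 _].
rewrite big_mkcond -big_split -sumrB; apply: eq_big_nat => n /andP[n0 _] /=.
have mn : m%:R <= M -> n%:R <= N -> (m * n)%:R <= x.
  by move=> mM nN; rewrite natrM -MNx ler_pM.
have mn' : ~~ (m%:R <= M) -> ~~ (n%:R <= N) -> ~~ ((m * n)%:R <= x).
  by rewrite -!ltNge => mM nN; rewrite natrM -MNx ltr_pM.
case: (boolP (m%:R <= M)) mn mn' => mM /= mn mn'; case: (boolP (n%:R <= N)) mn mn' => nN /= mn mn'.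
- by rewrite mn//; ring.
- by case: ifP => _; ring.
- by case: ifP => _; ring.
- by rewrite ifN ?mn'//; ring.
Qed.

End Hyperbola.

(** * Expansions x^2 P(ln x) with a power saving, under convolution *)

Section Asymptotics.
Variable R : realType.
Implicit Types (P Q G : {poly R}) (a b : nat -> R) (d e : nat) (al be ga ep x u : R).

(** [d] plays the role of the order of the pole at s = 2, hence adds under convolution; [al] is the
    saving over x^2. *)
Definition asym a d al := exists2 P : {poly R}, (size P <= d)%N &
  isO (fun x => summatory a x - x ^+ 2 * P.[ln x]) (2 - al).

Lemma horner_scaleX P u x : (P \Po (u *: 'X)).[x] = P.[u * x].
Proof. by rewrite horner_comp !hornerE. Qed.

Lemma size_scaleX P u : (size (P \Po (u *: 'X)) <= size P)%N.
Proof.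
have [->|P0] := eqVneq P 0; first by rewrite comp_poly0.
rewrite (leq_trans (size_comp_poly_leq _ _))//.
have : (size (u *: 'X : {poly R}) <= 2)%N.
  by rewrite (leq_trans (size_scale_leq _ _))// size_polyX.
move=> s2; rewrite -[X in (_ <= X)%N](prednK (n := size P)) ?ltnS ?size_poly_gt0//.
by rewrite -[X in (_ <= X)%N]muln1 leq_mul2l; case: (size _) s2 => [|[|[]]]//; rewrite orbT.
Qed.

Lemma ln_powRx x u : ln (x `^ u) = u * ln x.
Proof. exact: ln_powR. Qed.

Lemma isO_asym a d al ep : 0 < ep -> 0 <= al -> asym a d al ->
  isO (fun x => summatory a x) (2 + ep).
Proof.
move=> ep0 al0 [P _ HP].
apply: (isO_eq (g := fun x => (summatory a x - x ^+ 2 * P.[ln x]) + x ^+ 2 * P.[ln x])).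
  by move=> x _; rewrite subrK.
apply: isO_add; last by apply: isO_mul; [exact: isO_sqr|exact: isO_poly].
by apply: isO_weak HP; lra.
Qed.

Lemma size_nderivn_leq P n : (size P^`N(n) <= size P - n)%N.
Proof. exact: size_poly. Qed.

(* Half of the hyperbola: the main term of the inner sum is expanded by
   Taylor's formula around ln x and summed with [partial_summation]. *)
Lemma half_hyperbola a b d e al be u ga : (forall n, 0 <= a n) ->
  0 < al <= 1 -> 0 < be -> 0 < u -> 0 < ga -> ga < u * al -> ga < (1 - u) * be ->
  asym a d al -> asym b e be ->
  exists2 S : {poly R}, (size S <= d + e)%N &
    isO (fun x => \sum_(1 <= m < (Num.truncn (x `^ u)).+1) a m * summatory b (x / m%:R)
                  - x ^+ 2 * S.[ln x]) (2 - ga).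
Proof.
move=> a0 /andP[al0 al1] be0 u0 ga0 gaa gab [P sP HP] [Q sQ HQ].
have u1 : u < 1.
  have : 0 < (1 - u) * be by apply: lt_trans gab.
  by rewrite pmulr_lgt0// subr_gt0.
(* Midway between ga and u * al, so that an error (x^u)^(-de) = x^(-ga1) leaves room for a power of
   the logarithm. *)
pose ga1 := (ga + u * al) / 2.
pose de := ga1 / u.
have ude : u * de = ga1 by rewrite /de mulrC divfK// gt_eqF.
have de0 : 0 < de by rewrite divr_gt0// /ga1; lra.
have deal : de < al by rewrite ltr_pdivrMr// mulrC /ga1; lra.
have /choice[G HG] i : exists G : {poly R}, (size G <= d + i.+1)%N /\
    isO (fun x => summatory (fun m => a m / m%:R ^+ 2 * ln m%:R ^+ i) x - G.[ln x]) (- de).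
  have [G sG HG] := partial_summation i de0 deal al1 HP.
  by exists G; split => //; rewrite (leq_trans sG)// leq_add2r.
pose sg i x := summatory (fun m => a m / m%:R ^+ 2 * ln m%:R ^+ i) x.
have sgE i x : sg i x =
  \sum_(1 <= m < (Num.truncn x).+1) a m / m%:R ^+ 2 * ln m%:R ^+ i by [].
exists (\sum_(i < size Q) ((-1) ^+ i *: Q^`N(i)) * (G i \Po (u *: 'X))).
  rewrite (leq_trans (size_sum _ _ _))//; apply/bigmax_leqP => i _.
  rewrite (leq_trans (size_polyMleq _ _))//.
  have s1 : (size ((-1) ^+ i *: Q^`N(i)) <= e - i)%N.
    rewrite (leq_trans (size_scale_leq _ _))// (leq_trans (size_nderivn_leq _ _))//.
    by rewrite leq_sub2r.
  have s2 : (size (G i \Po (u *: 'X)) <= d + i.+1)%N.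
    by rewrite (leq_trans (size_scaleX _ _))//; have [] := HG i.
  have ie := leq_trans (ltn_ord i) sQ; rewrite -subn1 leq_subLR.
  apply: leq_trans (leq_add s1 s2) _.
  by move: ie; clear; move: (nat_of_ord i) => k; lia.
pose Eb y := summatory b y - y ^+ 2 * Q.[ln y].
pose MU x := (Num.truncn (x `^ u)).+1.
apply: (isO_eq (g := fun x =>
    \sum_(i < size Q) x ^+ 2 * ((-1) ^+ i *: Q^`N(i)).[ln x]
                      * (sg i (x `^ u) - (G i).[ln (x `^ u)])
    + \sum_(1 <= m < MU x) a m * Eb (x / m%:R))) => [x x1|].
  have x0 : 0 < x by apply: lt_le_trans x1.
  have -> : \sum_(1 <= m < MU x) a m * Eb (x / m%:R) =
      \sum_(1 <= m < MU x) a m * summatory b (x / m%:R) -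
      \sum_(i < size Q) x ^+ 2 * ((-1) ^+ i *: Q^`N(i)).[ln x] * sg i (x `^ u).
    under [X in _ = _ - X]eq_bigr => i _ do rewrite sgE mulr_sumr.
    rewrite [X in _ = _ - X]exchange_big -sumrB; apply: eq_big_nat => m /andP[m0 _].
    have m0' : 0 < m%:R :> R by rewrite ltr0n.
    rewrite /Eb ln_div ?posrE// nderiv_taylor; last exact: mulrC.
    rewrite mulrBr; congr (_ - _).
    rewrite !mulr_sumr; apply: eq_bigr => i _.
    rewrite hornerZ [(- ln _) ^+ i]exprNn expr_div_n.
    by ring.
  rewrite horner_sum mulr_sumr.
  have -> : \sum_(i < size Q) x ^+ 2 *
        (((-1) ^+ i *: Q^`N(i)) * (G i \Po (u *: 'X))).[ln x] =
      \sum_(i < size Q) x ^+ 2 * ((-1) ^+ i *: Q^`N(i)).[ln x] * (G i).[ln (x `^ u)].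
    by apply: eq_bigr => i _; rewrite hornerM horner_scaleX ln_powRx mulrA.
  under [in RHS]eq_bigr => i _ do rewrite mulrBr.
  by rewrite sumrB; ring.
pose ep := (u * al - ga) / 2.
have ep0 : 0 < ep by rewrite /ep; lra.
apply: isO_add.
  apply: isO_sum => i; have [_ Hi] := HG i.
  apply: (isO_weak (th := (2 + ep) + u * (- de))).
    by rewrite mulrN ude /ep /ga1; lra.
  apply: isO_mul; last exact: isO_comp (ltW u0) Hi.
  by apply: isO_mul; [exact: isO_sqr|exact: isO_poly].
have [C C0 HC] := isO_ge0 HQ.
(* For m <= x^u, (x / m)^(2-be) is at most x^(2-be) * x^(u*be) / m^2. As a is nonnegative, the
   remaining sum is [sg 0], which may grow like x^ep'. *)
pose ep' := (1 - u) * be - ga.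
have ep'0 : 0 < ep' by rewrite subr_gt0.
have O0 : isO (fun x => sg 0%N (x `^ u)) ep'.
  apply: (isO_eq (g := fun x => (sg 0%N (x `^ u) - (G 0%N).[ln (x `^ u)])
      + (G 0%N \Po (u *: 'X)).[ln x])) => [x _|].
    by rewrite horner_scaleX ln_powRx subrK.
  apply: isO_add; last exact: isO_poly.
  have [_ H0] := HG 0%N; apply: isO_weak (isO_comp (ltW u0) H0).
  by rewrite mulrN ude; rewrite /ga1; lra.
have Odom := isO_mul (isO_scale C (isO_pow (2 - be + u * be))) O0.
apply: (isO_le _ _ Odom); first by rewrite /ep'; lra.
move=> x x1; have x0 : 0 < x by apply: lt_le_trans x1.
rewrite (le_trans (ler_norm_sum _ _ _))// (le_trans _ (ler_norm _))//.
rewrite sgE mulr_sumr [leLHS]big_nat [leRHS]big_nat.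
apply: ler_sum => m /andP[m0 mM].
have mu : m%:R <= x `^ u by rewrite -truncn_ge_nat ?powR_ge0// -ltnS.
have m0' : 0 < m%:R :> R by rewrite ltr0n.
have xu : x `^ u <= x by rewrite -[leRHS]powRr1 ?(ltW x0)// ler_powR// ltW.
have xm1 : 1 <= x / m%:R by rewrite ler_pdivlMr// mul1r (le_trans mu).
rewrite normrM (ger0_norm (a0 m)) expr0 mulr1.
rewrite (le_trans (ler_wpM2l (a0 m) (HC _ xm1)))//.
have -> : C * x `^ (2 - be + u * be) * (a m / m%:R ^+ 2) =
    a m * (C * (x `^ (2 - be + u * be) / m%:R ^+ 2)) by ring.
rewrite !ler_wpM2l// powRM ?invr_ge0 ?(ltW x0) ?(ltW m0')//.
rewrite (@powRD _ _ (2 - be)); last by apply/implyP => _; rewrite gt_eqF.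
rewrite -mulrA ler_wpM2l ?powR_ge0// ler_pdivlMr ?exprn_gt0//.
rewrite -powR_inv1 ?(ltW m0')// -powRrM -powR_mulrn ?(ltW m0')//.
rewrite -powRD; last by apply/implyP => _; rewrite gt_eqF.
have -> : -1 * (2 - be) + 2%:R = be by ring.
by rewrite powRrM ge0_ler_powR ?nnegrE ?powR_ge0 ?(ltW m0') ?(ltW be0).
Qed.

Lemma asym_conv a b d e al be ga :
  (forall n, 0 <= a n) -> (forall n, 0 <= b n) -> 0 < al <= 1 -> 0 < be <= 1 ->
  0 < ga -> ga * (al + be) < al * be -> asym a d al -> asym b e be ->
  asym (conv a b) (d + e) ga.
Proof.
move=> a0 b0 al01 be01 ga0 gaab Ha Hb.
have [[al0 al1] [be0 be1]] := (andP al01, andP be01).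
have s0 : 0 < al + be by rewrite addr_gt0.
(* This choice balances the two halves: u * al = (1 - u) * be. *)
pose u := be / (al + be); pose v := al / (al + be).
have u0 : 0 < u by rewrite divr_gt0.
have v0 : 0 < v by rewrite divr_gt0.
have uv : 1 - u = v by rewrite /u /v; field; rewrite gt_eqF.
have vu : 1 - v = u by rewrite -uv; ring.
have gau : ga < u * al by rewrite /u mulrAC ltr_pdivlMr// (mulrC be).
have gav : ga < v * be by rewrite /v mulrAC ltr_pdivlMr.
have [S1 sS1 H1] := half_hyperbola a0 al01 be0 u0 ga0 gau
  (eq_ind_r (fun t => ga < t * be) gav uv) Ha Hb.
have [S2 sS2 H2] := half_hyperbola b0 be01 al0 v0 ga0 gav
  (eq_ind_r (fun t => ga < t * al) gau vu) Hb Ha.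
have [P sP HP] := Ha; have [Q sQ HQ] := Hb.
pose PQ := (P \Po (u *: 'X)) * (Q \Po (v *: 'X)).
have sPQ : (size PQ <= d + e)%N.
  rewrite (leq_trans (size_polyMleq _ _))// (leq_trans (leq_pred _))//.
  by rewrite leq_add// (leq_trans (size_scaleX _ _)).
exists (S1 + S2 - PQ).
  rewrite (leq_trans (size_polyD _ _))// geq_max size_polyN sPQ andbT.
  by rewrite (leq_trans (size_polyD _ _))// geq_max sS1 addnC.
pose M x := x `^ u; pose N x := x `^ v.
have MN x : 1 <= x -> M x * N x = x.
  move=> x1; have x0 : 0 < x by apply: lt_le_trans x1.
  rewrite /M /N -powRD; last by apply/implyP => _; rewrite gt_eqF.
  by rewrite -uv addrC subrK powRr1// ltW.
pose Ea y := summatory a y - y ^+ 2 * P.[ln y].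
pose Eb y := summatory b y - y ^+ 2 * Q.[ln y].
(* The product of the two summatory functions is peeled one factor at a time, as in S_a S_b = E_a
   S_b + main_a E_b + main_a main_b; the last product is x^2 PQ(ln x). *)
apply: (isO_eq (g := fun x =>
    (\sum_(1 <= m < (Num.truncn (M x)).+1) a m * summatory b (x / m%:R)
       - x ^+ 2 * S1.[ln x])
  + (\sum_(1 <= m < (Num.truncn (N x)).+1) b m * summatory a (x / m%:R)
       - x ^+ 2 * S2.[ln x])
  - (Ea (M x) * summatory b (N x) + M x ^+ 2 * P.[ln (M x)] * Eb (N x)))) => [x x1|].
  rewrite (hyperbola a b (powR_ge1 x1 (ltW u0)) (powR_ge1 x1 (ltW v0)) (MN _ x1)).
  rewrite !(hornerD, hornerN) hornerM !horner_scaleX -!ln_powRx -/(M x) -/(N x) /Ea /Eb.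
  have -> : x ^+ 2 = M x ^+ 2 * N x ^+ 2 by rewrite -exprMn MN.
  by ring.
apply: isO_sub; first exact: isO_add.
pose ep := u * al - ga; have ep0 : 0 < ep by rewrite subr_gt0.
have epE : u * al = ga + ep by rewrite /ep; ring.
clearbody ep.
have gE : v * be = u * al by rewrite /u /v; field; rewrite gt_eqF.
have u1 : u < 1 by rewrite -subr_gt0 uv.
have v1 : v < 1 by rewrite -subr_gt0 vu.
apply: isO_add.
  apply: (isO_weak (th := u * (2 - al) + v * (2 + ep))).
    have : 0 <= u * ep by rewrite mulr_ge0 ?ltW.
    have : v * ep = ep - u * ep by rewrite -uv; ring.
    by rewrite mulrBr mulrDr epE; lra.
  apply: isO_mul; first exact: (isO_comp (ltW u0) HP).
  apply: (isO_comp (ltW v0) (f := summatory b)).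
  exact: isO_asym ep0 (ltW be0) Hb.
apply: (isO_weak (th := u * (2 + ep) + v * (2 - be))).
  have : 0 <= v * ep by rewrite mulr_ge0 ?ltW.
  have : u * ep = ep - v * ep by rewrite -vu; ring.
  by rewrite mulrBr mulrDr gE epE; lra.
apply: isO_mul; last exact: (isO_comp (ltW v0) HQ).
apply: (isO_comp (ltW u0) (f := fun y => y ^+ 2 * P.[ln y])).
by apply: isO_mul; [exact: isO_sqr|exact: isO_poly].
Qed.

End Asymptotics.

(** * Convolution with a summable function, and the two initial expansions *)

Section BaseCases.
Variable R : realType.
Implicit Types (P Q G : {poly R}) (a b h : nat -> R) (al x : R).

(** The hyperbola identity with M = 1, where the first sum cancels against the product. *)
Lemma summatory_conv_swap a h x : 1 <= x -> summatory (conv a h) x =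
  \sum_(1 <= n < (Num.truncn x).+1) h n * summatory a (x / n%:R).
Proof.
move=> x1; rewrite (hyperbola a h (lexx 1) x1 (mul1r x)).
have -> : summatory a 1 = a 1%N by rewrite /summatory truncn1 big_nat1.
by rewrite truncn1 big_nat1 divr1; ring.
Qed.

(** Here h may change sign. The sums of h n / n^2 * (ln n)^i converge to constants instead of
    growing, so neither the size nor the saving deteriorates. *)
Lemma asym_conv_summable a h d al tau H : 0 < al -> al + tau < 2 ->
  (forall N, \sum_(1 <= n < N.+1) `|h n| * n%:R `^ (- tau) <= H) ->
  asym a d al -> asym (conv a h) d al.
Proof.
move=> al0 altau HH [P sP HP].
have [C C0 HC] := isO_ge0 HP.
(* One ep pays for (ln n)^i in the tails, the other for the derivatives of P at ln x. *)
pose ep := (2 - tau - al) / 2.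
have ep0 : 0 < ep by rewrite /ep; lra.
have tauE : tau = 2 - al - 2 * ep by rewrite /ep; lra.
clearbody ep.
pose sg (i : nat) x := \sum_(1 <= n < (Num.truncn x).+1) h n / n%:R ^+ 2 * ln n%:R ^+ i.
have /choice[c Hc] i : exists c, isO (fun x => sg i x - c) (- (al + ep)).
  have [C1 C10 HC1] := horner_le_expR 'X^i ep0.
  pose v x := C1 * H * x `^ (- (al + ep)).
  have H0 : 0 <= H by apply: le_trans (HH 0%N); rewrite big_geq.
  have v0 x : 0 <= v x by rewrite !mulr_ge0 ?powR_ge0.
  have osc (s t : R) : 1 <= s -> s <= t -> `|sg i t - sg i s| <= v s.
    move=> s1 st; have s0 : 0 < s by apply: lt_le_trans s1.
    have Nst : ((Num.truncn s).+1 <= (Num.truncn t).+1)%N by rewrite ltnS le_truncn.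
    rewrite /sg (big_cat_nat (n := (Num.truncn s).+1) _ Nst)//= addrC addrK.
    rewrite (le_trans (ler_norm_sum _ _ _))//.
    apply: (@le_trans _ _ (\sum_((Num.truncn s).+1 <= n < (Num.truncn t).+1)
        C1 * s `^ (- (al + ep)) * (`|h n| * n%:R `^ (- tau)))).
      rewrite big_nat [leRHS]big_nat; apply: ler_sum => n /andP[sn _].
      have n0 : (0 < n)%N by apply: leq_trans sn.
      have n0' : 0 < n%:R :> R by rewrite ltr0n.
      have sn' : s <= n%:R.
        by rewrite (le_trans (ltW (truncnS_gt s)))// ler_nat.
      have n1 : 1 <= n%:R :> R by rewrite ler1n.
      rewrite normrM normrM (ger0_norm (x := (n%:R ^+ 2)^-1)) ?invr_ge0 ?exprn_ge0//.
      rewrite mulrCA -mulrA ler_wpM2l//.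
      have := HC1 _ (ln_ge0 n1); rewrite hornerXn -powR_expR// => h1.
      rewrite (le_trans (ler_wpM2l _ h1)) ?invr_ge0 ?exprn_ge0//.
      rewrite mulrCA -!mulrA ler_wpM2l//.
      rewrite -powR_mulrn ?(ltW n0')// -powRN -powRD; last first.
        by apply/implyP => _; rewrite gt_eqF.
      have -> : - 2%:R + ep = - (al + ep) + - tau by rewrite tauE; ring.
      rewrite powRD; last by apply/implyP => _; rewrite gt_eqF.
      rewrite ler_wpM2r ?powR_ge0// !powRN lef_pV2 ?posrE ?powR_gt0//.
      rewrite ge0_ler_powR ?nnegrE ?(ltW s0) ?(ltW n0')//; lra.
    rewrite -mulr_sumr /v mulrAC ler_wpM2r ?powR_ge0// ler_wpM2l//.
    apply: le_trans (HH (Num.truncn t)).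
    rewrite [leRHS](big_cat_nat (n := (Num.truncn s).+1) _ Nst)//= lerDr.
    by rewrite sumr_ge0// => n _; rewrite mulr_ge0 ?powR_ge0.
  have [|s t s1 t1|L HL] := @limit_of_oscillation R R (fun x => 1 <= x) (sg i) v.
  - by exists 1.
  - have vs := v0 s; have vt := v0 t.
    have [st|/ltW ts] := leP s t.
      by have := osc _ _ s1 st; rewrite ler_distl => /andP[+ _]; lra.
    by have := osc _ _ t1 ts; rewrite ler_distl => /andP[_ +]; lra.
  by exists L, (C1 * H).
exists (\sum_(i < size P) ((-1) ^+ i * c i) *: P^`N(i)).
  rewrite (leq_trans (size_sum _ _ _))//; apply/bigmax_leqP => i _.
  rewrite (leq_trans (size_scale_leq _ _))// (leq_trans (size_nderivn_leq _ _))//.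
  by rewrite (leq_trans (leq_subr _ _)).
pose Ea y := summatory a y - y ^+ 2 * P.[ln y].
apply: (isO_eq (g := fun x =>
    \sum_(i < size P) x ^+ 2 * ((-1) ^+ i *: P^`N(i)).[ln x] * (sg i x - c i)
    + \sum_(1 <= n < (Num.truncn x).+1) h n * Ea (x / n%:R))) => [x x1|].
  have x0 : 0 < x by apply: lt_le_trans x1.
  rewrite summatory_conv_swap//.
  have -> : \sum_(1 <= n < (Num.truncn x).+1) h n * Ea (x / n%:R) =
      \sum_(1 <= n < (Num.truncn x).+1) h n * summatory a (x / n%:R) -
      \sum_(i < size P) x ^+ 2 * ((-1) ^+ i *: P^`N(i)).[ln x] * sg i x.
    under [X in _ = _ - X]eq_bigr => i _ do rewrite mulr_sumr.
    rewrite [X in _ = _ - X]exchange_big -sumrB; apply: eq_big_nat => n /andP[n0 _].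
    have n0' : 0 < n%:R :> R by rewrite ltr0n.
    rewrite /Ea ln_div ?posrE// nderiv_taylor; last exact: mulrC.
    rewrite mulrBr; congr (_ - _).
    rewrite !mulr_sumr; apply: eq_bigr => i _.
    rewrite hornerZ [(- ln _) ^+ i]exprNn expr_div_n.
    by ring.
  under [in RHS]eq_bigr => i _ do rewrite mulrBr.
  rewrite horner_sum mulr_sumr sumrB.
  have -> : \sum_(i < size P) x ^+ 2 * (((-1) ^+ i * c i) *: P^`N(i)).[ln x] =
      \sum_(i < size P) x ^+ 2 * ((-1) ^+ i *: P^`N(i)).[ln x] * c i.
    by apply: eq_bigr => i _; rewrite !hornerZ; ring.
  by ring.
apply: isO_add.
  apply: isO_sum => i.
  apply: (isO_weak (th := (2 + ep) + - (al + ep))); first lra.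
  apply: isO_mul; last exact: Hc.
  by apply: isO_mul; [exact: isO_sqr|exact: isO_poly].
exists (C * H) => x x1; have x0 : 0 < x by apply: lt_le_trans x1.
rewrite (le_trans (ler_norm_sum _ _ _))//.
rewrite mulrAC; apply: le_trans (ler_wpM2l _ (HH (Num.truncn x))); last first.
  by rewrite mulr_ge0 ?powR_ge0.
rewrite mulr_sumr [leLHS]big_nat [leRHS]big_nat.
apply: ler_sum => n /andP[n0 nx].
have n0' : 0 < n%:R :> R by rewrite ltr0n.
have nx' : n%:R <= x by rewrite -truncn_ge_nat ?(ltW x0)// -ltnS.
have xn1 : 1 <= x / n%:R by rewrite ler_pdivlMr// mul1r.
rewrite normrM mulrCA ler_wpM2l// (le_trans (HC _ xn1))// -mulrA ler_wpM2l//.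
rewrite powRM ?invr_ge0 ?(ltW x0) ?(ltW n0')// ler_wpM2l ?powR_ge0//.
rewrite -powR_inv1 ?(ltW n0')// -powRrM ler_powR ?ler1n//; lra.
Qed.

Lemma sum_nat_id N : (\sum_(1 <= n < N.+1) n%:R) * 2 = N%:R * (N%:R + 1) :> R.
Proof.
elim: N => [|N IH]; first by rewrite big_geq// !mul0r.
by rewrite big_nat_recr//= mulrDl IH -(natr1 N); ring.
Qed.

Lemma sum_nat_cube N :
  (\sum_(1 <= n < N.+1) n%:R ^+ 3) * 4 = (N%:R * (N%:R + 1)) ^+ 2 :> R.
Proof.
elim: N => [|N IH]; first by rewrite big_geq// !mul0r expr0n.
by rewrite big_nat_recr//= mulrDl IH -(natr1 N); ring.
Qed.

Lemma truncn_bounds x : 1 <= x ->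
  [/\ 0 <= (Num.truncn x)%:R :> R, (Num.truncn x)%:R <= x & x < (Num.truncn x)%:R + 1].
Proof.
move=> x1; have x0 : 0 <= x by apply: le_trans x1.
by split; rewrite ?truncn_le// natr1 truncnS_gt.
Qed.

Lemma asym_id : asym (fun n => n%:R : R) 1 1.
Proof.
exists (2^-1)%:P; first exact: size_polyC_leq1.
exists 1 => x x1; have [n0 nx xn] := truncn_bounds x1.
have -> : x `^ (2 - 1) = x by rewrite (_ : 2 - 1 = 1) ?powRr1//; lra.
have := sum_nat_id (Num.truncn x); rewrite /summatory hornerC mul1r.
set S := bigop _ _ _; set N := (Num.truncn x)%:R in n0 nx xn * => h.
have t1 : N * (N + 1) <= x * (x + 1) by rewrite ler_pM//; lra.
have t2 : (x - 1) * x <= N * (N + 1) by rewrite ler_pM//; lra.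
by rewrite ler_norml expr2; apply/andP; split; lra.
Qed.

(** With y = x^(1/2), the sum of m^3 over m <= y is y^4 / 4 + O(y^3), and y^3 = x^(3/2). *)
Lemma asym_square_cube (q : nat -> R) : (forall m, (0 < m)%N -> q (m ^ 2)%N = m%:R ^+ 3) ->
  (forall n, (0 < n)%N -> (forall m, n != m ^ 2)%N -> q n = 0) ->
  asym q 1 (1 / 2).
Proof.
move=> qsq q0.
exists (4^-1)%:P; first exact: size_polyC_leq1.
exists 1 => x x1; have x0 : 0 <= x by apply: le_trans x1.
pose y := x `^ (2^-1).
have y1 : 1 <= y by rewrite powR_ge1// invr_ge0.
have y0 : 0 <= y by apply: le_trans y1.
have yx : y ^+ 2 = x by rewrite /y -powR_mulrn ?powR_ge0// -powRrM mulVf// powRr1.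
have -> : x `^ (2 - 1 / 2) = y ^+ 3.
  by rewrite /y -powR_mulrn ?powR_ge0// -powRrM; congr powR; lra.
have -> : summatory q x = summatory (fun m => m%:R ^+ 3) y.
  pose X := Num.truncn x.
  have yX : (Num.truncn y <= X)%N.
    by rewrite le_truncn// -yx expr2 ler_peMl.
  rewrite (summatoryE _ x0 (leqnn _)) (summatoryE _ y0 yX) -/X.
  transitivity (\sum_(1 <= n < X.+1) \sum_(1 <= m < X.+1)
      if (n%:R <= x) && (n == m ^ 2)%N then m%:R ^+ 3 else 0 : R).
    rewrite big_mkcond; apply: eq_big_nat => n /andP[n0 nX].
    case: ifP => nx /=; last by rewrite big1.
    rewrite -big_mkcond.
    have [[m /eqP nm]|nsq] := pselect (exists m, n == m ^ 2)%N.
      have m0 : (0 < m)%N by move: n0; rewrite nm expn_gt0 orbF.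
      rewrite (eq_bigl (fun k => k == m)) => [|k].
        rewrite big_nat1_eq nm qsq// ifT// m0 (leq_ltn_trans _ nX)// nm.
        by rewrite -[X in (X <= _)%N]muln1 leq_mul2l m0 orbT.
      by rewrite nm eqn_exp2r// eq_sym.
    rewrite q0// => [|m]; last by apply/negP => nm; apply: nsq; exists m.
    by rewrite big1// => m nm; case: nsq; exists m.
  rewrite exchange_big [RHS]big_mkcond; apply: eq_big_nat => m /andP[m0 mX].
  rewrite -big_mkcond (big_nat1_cond_eq _ _ (fun k => k%:R <= x)).
  have -> : ((m ^ 2)%:R <= x) = (m%:R <= y).
    by rewrite natrX -yx ler_sqr ?nnegrE.
  case: (boolP (m%:R <= y)) => my; last by rewrite andbF.
  rewrite andbT expn_gt0 m0 ifT// ltnS truncn_ge_nat// natrX -yx.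
  by rewrite ler_sqr ?nnegrE.
have [n0 ny yn] := truncn_bounds y1.
have := sum_nat_cube (Num.truncn y); rewrite /summatory hornerC mul1r.
rewrite -yx; set S := bigop _ _ _; set N := (Num.truncn y)%:R in n0 ny yn * => h.
have [t1 t2] : (N * (N + 1)) <= y * (y + 1) /\ (y - 1) * y <= N * (N + 1).
  by split; rewrite ler_pM//; lra.
have [t3 t4] : (N * (N + 1)) ^+ 2 <= (y * (y + 1)) ^+ 2 /\
    ((y - 1) * y) ^+ 2 <= (N * (N + 1)) ^+ 2.
  by split; rewrite ler_sqr ?nnegrE ?mulr_ge0//; lra.
have y2 : y ^+ 2 <= y ^+ 3 by rewrite ler_weXn2l.
have y20 := sqr_ge0 y.
have e1 : (y * (y + 1)) ^+ 2 = (y ^+ 2) ^+ 2 + 2 * y ^+ 3 + y ^+ 2 by ring.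
have e2 : ((y - 1) * y) ^+ 2 = (y ^+ 2) ^+ 2 - 2 * y ^+ 3 + y ^+ 2 by ring.
by rewrite ler_norml; apply/andP; split; lra.
Qed.

End BaseCases.

(** * Bounds on local coefficients and on sums of Euler products *)

Section LocalBounds.
Variable R : realType.
Implicit Types (p v n N : nat).

Lemma cube_local1 p : cube_local R p 1 = 4 * p%:R + 16.
Proof.
have h : (\sum_(i < 4) min_sum p i (3 - i) = 4 * p + 16)%N.
  by rewrite /min_sum !big_ord_recr !big_ord0 /= /minn /= !expn0 !expn1; lia.
by rewrite /cube_local -natr_sum (h : \sum_(i < (3 * 1).+1) _ = _)%N natrD natrM.
Qed.

Lemma cube_local2 p :
  cube_local R p 2 = p%:R ^+ 3 + 9 * p%:R ^+ 2 + 25 * p%:R + 49.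
Proof.
have h : (\sum_(i < 7) min_sum p i (6 - i) = p ^ 3 + 9 * p ^ 2 + 25 * p + 49)%N.
  rewrite /min_sum !big_ord_recr !big_ord0 /= /minn /= !expn0 !expn1.
  by ring.
rewrite /cube_local -natr_sum (h : \sum_(i < (3 * 2).+1) _ = _)%N.
by rewrite natrD !natrD !natrM; ring.
Qed.

Lemma residual_local1 p : residual_local R p 1 = 16.
Proof.
rewrite /residual_local !cauchy_linear_factor /=.
by rewrite cube_local0 cube_local1; ring.
Qed.

(** The p^3 is cancelled by 1 - p^3 X^2; the remaining order p^2 is harmless at weight p^(-26/7). *)
Lemma residual_local2 p :
  residual_local R p 2 = - p%:R ^+ 2 - 39 * p%:R + 49.
Proof.
rewrite /residual_local !cauchy_linear_factor /=.
by rewrite cube_local0 cube_local1 cube_local2; ring.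
Qed.

(** There are at most (3v+1)^3 terms p^(min a b), and min a b <= (a+b)/2 <= 3v/2. The hypothesis r^2
    = p^3 stands for r = p^(3/2) and keeps all powers integral. *)
Lemma cube_local_le p v (r : R) : (0 < p)%N -> 0 <= r -> r ^+ 2 = p%:R ^+ 3 :> R ->
  `|cube_local R p v| <= 27 * v.+1%:R ^+ 3 * r ^+ v.
Proof.
move=> p0 r0 r2.
have minle a b : (a + b <= 3 * v)%N -> (p ^ minn a b)%:R <= r ^+ v.
  move=> abv; rewrite -(ler_sqr (x := _%:R)) ?nnegrE ?exprn_ge0//.
  rewrite -natrX exprAC r2 -!exprM -natrX ler_nat -expnM leq_pexp2l//.
  by rewrite (leq_trans _ abv)// muln2 -addnn leq_add ?geq_minl ?geq_minr.
rewrite ger0_norm; last by rewrite sumr_ge0.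
apply: (@le_trans _ _ (\sum_(i < (3 * v).+1) (3 * v).+1%:R ^+ 2 * r ^+ v)).
  apply: ler_sum => i _; have iv : (i <= 3 * v)%N by rewrite -ltnS.
  rewrite /min_sum natr_sum.
  apply: (@le_trans _ _ (\sum_(a < i.+1) \sum_(b < (3 * v - i).+1) r ^+ v)).
    apply: ler_sum => a _; rewrite natr_sum; apply: ler_sum => b _.
    apply: minle; have ai : (a <= i)%N by rewrite -ltnS.
    have bi : (b <= 3 * v - i)%N by rewrite -ltnS.
    by rewrite (leq_trans (leq_add ai bi))// subnKC.
  rewrite sumr_const sumr_const !card_ord -mulrnA -[leLHS]mulr_natl ler_wpM2r ?exprn_ge0//.
  by rewrite -natrX ler_nat -mulnn leq_mul// ltnS ?leq_subr.
rewrite sumr_const card_ord -[leLHS]mulr_natl mulrA -exprS ler_wpM2r ?exprn_ge0//.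
rewrite (_ : 27 = 3 ^+ 3); last by ring.
by rewrite -exprMn lerXn2r ?nnegrE// -natrM ler_nat mulnS -add1n leq_add2r.
Qed.

(** Each linear factor only doubles the constant, so five of them turn 27 into 864. *)
Lemma cauchy_linear_factor_le (F : nat -> nat -> R) t (c : nat -> R) p (C r : R) : (0 < t)%N -> 0 <= r ->
  `|c p| <= r ^+ t -> (forall v, `|F p v| <= C * v.+1%:R ^+ 3 * r ^+ v) ->
  forall v, `|cauchy (linear_factor t c) F p v| <= 2 * C * v.+1%:R ^+ 3 * r ^+ v :> R.
Proof.
move=> t0 r0 cr HF v; rewrite cauchy_linear_factor (le_trans (ler_normB _ _))//.
have C0 : 0 <= C.
  have := HF 0%N; rewrite mulr1n expr1n expr0 !mulr1 => h.
  exact: le_trans (normr_ge0 _) h.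
set B := v.+1%:R ^+ 3; have -> : 2 * C * B * r ^+ v = C * B * r ^+ v + C * B * r ^+ v by ring.
apply: lerD; first exact: HF.
case: leqP => tv; last first.
  by rewrite normr0 !mulr_ge0 ?exprn_ge0.
rewrite normrM -[X in _ * r ^+ X](subnKC tv) exprD mulrCA.
apply: ler_pM => //; apply: le_trans (HF _) _.
rewrite ler_wpM2r ?exprn_ge0// ler_wpM2l// lerXn2r ?nnegrE// ler_nat.
by rewrite ltnS leq_subr.
Qed.

Lemma residual_local_le p v (r : R) : (0 < p)%N -> 0 <= r -> r ^+ 2 = p%:R ^+ 3 :> R ->
  `|residual_local R p v| <= 864 * v.+1%:R ^+ 3 * r ^+ v.
Proof.
move=> p0 r0 r2.
have p1 : 1 <= p%:R :> R by rewrite ler1n.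
have pr : `|p%:R| <= r ^+ 1.
  rewrite ger0_norm// expr1 -ler_sqr ?nnegrE// r2.
  by rewrite ler_weXn2l.
have pr2 : `|p%:R ^+ 3| <= r ^+ 2 by rewrite r2 ger0_norm ?exprn_ge0.
have -> : 864 = 2 * (2 * (2 * (2 * (2 * 27)))) :> R by ring.
move: v; do 4![apply: cauchy_linear_factor_le => //].
apply: cauchy_linear_factor_le => // v.
exact: cube_local_le.
Qed.

(** Half of the exponential decay absorbs the cubic factor; the other half is a geometric series. *)
Lemma sum_cube_geometric (rho : R) : 0 < rho < 1 ->
  exists C : R, forall J, \sum_(v < J) v.+1%:R ^+ 3 * rho ^+ v <= C.
Proof.
move=> /andP[rho0 rho1].
have lnr : 0 < - ln rho by rewrite oppr_gt0 ln_lt0// rho0.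
pose e := - ln rho / 2; have e0 : 0 < e by rewrite divr_gt0.
have [C C0 HC] := horner_le_expR (('X + 1) ^+ 3) e0.
pose z := expR (- e); have z1 : z < 1 by rewrite expR_lt1 oppr_lt0.
exists (C * (1 - z)^-1) => J.
have rhoE : rho = expR (- (2 * e)).
  by rewrite /e mulrCA divff// mulr1 opprK lnK.
apply: (@le_trans _ _ (C * \sum_(v < J) z ^+ v)).
  rewrite mulr_sumr; apply: ler_sum => v _.
  have := HC v%:R (ler0n _ _); rewrite horner_exp hornerD hornerX hornerC natr1.
  rewrite ger0_norm ?exprn_ge0// => h.
  rewrite (le_trans (ler_wpM2r (exprn_ge0 _ (ltW rho0)) h))// -mulrA ler_wpM2l//.
  rewrite rhoE /z -!expRM_natl -expRD ler_expR.
  by rewrite le_eqVlt; apply/orP; left; apply/eqP; ring.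
rewrite ler_wpM2l// -[leRHS]mul1r ler_pdivlMr ?subr_gt0// mulrC.
have := subrX1 z J => h; have zJ : 0 <= z ^+ J by rewrite exprn_ge0 ?expR_ge0.
have -> : (1 - z) * (\sum_(i < J) z ^+ i) = 1 - z ^+ J.
  by rewrite -opprB mulNr -h opprB.
by rewrite gerBl.
Qed.

(** Expanding the product gives one nonnegative term per choice of exponents, and by unique
    factorisation the integers from 1 to N account for distinct choices. *)
Lemma euler_sum_le (W : nat -> nat -> R) N :
  (forall p v, 0 <= W p v) -> (forall p, W p 0%N = 1) ->
  \sum_(1 <= n < N.+1) euler W n <=
  \prod_(p < N.+1 | prime p) \sum_(v < N.+1) W p v.
Proof.
move=> W0 W1.
(* Series 1 at nonprimes, so that the product runs over all p and can be expanded over finite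
   functions. *)
pose W' p v : R := if prime p then W p v else (v == 0%N)%:R.
have W'0 p v : 0 <= W' p v by rewrite /W'; case: ifP.
have -> : \prod_(p < N.+1 | prime p) \sum_(v < N.+1) W p v =
    \prod_(p < N.+1) \sum_(v < N.+1) W' p v.
  rewrite big_mkcond; apply: eq_bigr => p _; rewrite /W'; case: ifP => // _.
  by rewrite big_ord_recl/= big1 ?addr0.
rewrite bigA_distr_bigA /=.
have -> : \sum_(1 <= n < N.+1) euler W n =
    \sum_(n < N.+1 | (0 < n)%N) \prod_(p < N.+1) W' p (logn p n).
  rewrite big_geq_mkord; apply: eq_bigr => n n0.
  rewrite /euler -(filter_pi_of (n := n) (m := N.+1))// big_filter big_mkord big_mkcond.
  apply: eq_bigr => p _; have -> : \pi(n) p = (0 < logn p n)%N by rewrite logn_gt0.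
  rewrite /W'; case: posnP => [->|pn].
    by case: ifP.
  by move: pn; rewrite logn_gt0 mem_primes => /andP[->].
pose phi (n : 'I_N.+1) := [ffun p : 'I_N.+1 => inord (logn p n) : 'I_N.+1].
have phiE (n : 'I_N.+1) (p : 'I_N.+1) : (0 < n)%N -> phi n p = logn p n :> nat.
  move=> n0; rewrite ffunE inordK// ltnS (leq_trans (ltnW (ltn_logl p n0)))//.
  by rewrite -ltnS.
pose A := [set n : 'I_N.+1 | (0 < n)%N]%SET.
have injphi : {in A &, injective phi}.
  move=> m n; rewrite !inE => m0 n0 mn; apply/val_inj/eqn_from_log => // p.
  have [pN|Np] := ltnP p N.+1; last first.
    by rewrite !ltn_log0 //; apply: leq_trans Np; exact: ltn_ord.
  by rewrite -!(phiE _ (Ordinal pN))// mn.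
rewrite (eq_bigl (fun n : 'I_N.+1 => n \in A)) => [|n]; last by rewrite inE.
rewrite (eq_bigr (fun n : 'I_N.+1 => \prod_(p < N.+1) W' p (phi n p))) => [|n]; last first.
  by rewrite inE => n0; apply: eq_bigr => p _; rewrite phiE.
rewrite -(big_imset (fun f : {ffun 'I_N.+1 -> 'I_N.+1} => \prod_(p < N.+1) W' p (f p)))//.
rewrite [leRHS](bigID (mem (phi @: A)%SET))/= lerDl sumr_ge0// => f _.
exact: prodr_ge0.
Qed.

End LocalBounds.

(** * Absolute summability of the residual factor h *)

Section ResidualBound.
Variable R : realType.
Implicit Types (p v n N J : nat).

Lemma sum_powR_le (d : R) N : 0 < d ->
  \sum_(1 <= n < N.+1) n%:R `^ (- 1 - d) <= 1 + d^-1.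
Proof.
move=> d0; case: N => [|N]; first by rewrite big_geq// addr_ge0// invr_ge0 ltW.
(* The sharper bound is the one that telescopes by [powR_diff]. *)
apply: (@le_trans _ _ (1 + d^-1 * (1 - N.+1%:R `^ (- d)))); last first.
  by rewrite lerD2l ler_piMr ?invr_ge0 ?(ltW d0)// gerBl powR_ge0.
elim: N => [|N IH]; first by rewrite big_nat1 !powR1 subrr mulr0 addr0.
rewrite big_nat_recr//=; have := powR_diff (isT : (0 < N.+1)%N) d0.
rewrite -ler_pdivlMl// => h; apply: le_trans (lerD IH h) _.
by rewrite le_eqVlt; apply/orP; left; apply/eqP; ring.
Qed.

Lemma euler_norm_powR (F : nat -> nat -> R) (t : R) n : (0 < n)%N ->
  (forall p, F p 0%N = 1) ->
  `|euler F n| * n%:R `^ t = euler (fun p v => `|F p v| * (p%:R `^ t) ^+ v) n.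
Proof.
move=> n0 F0; move: n n0; apply: prime_power_ind => [|p v m pr_p v0 copm m0 IH].
  by rewrite !euler1 normr1 powR1 mulr1.
rewrite !euler_pfactor ?F0 ?normr1 ?expr0 ?mulr1// -IH normrM natrM natrX.
by rewrite powRM ?exprn_ge0// -powR_mulrn// powRAC powR_mulrn ?powR_ge0// mulrACA.
Qed.

(* The exponent 13/7 only has to lie strictly between 11/6, where the bound on
   the terms with v = 3 breaks down, and 15/8. *)
Lemma residual_local_sum_le : exists2 C : R, 0 <= C & forall p J, prime p ->
  \sum_(v < J.+1) `|residual_local R p v| * (p%:R `^ (- (13 / 7))) ^+ v
    <= 1 + C * p%:R `^ (- 1 - 1 / 14).
Proof.
(* Since 3/2 - 13/7 = -5/14, this is the largest value over primes of p^(3/2) * p^(-13/7). *)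
pose rho : R := 2 `^ (- (5 / 14)).
have rho0 : 0 < rho by rewrite powR_gt0.
have rho1 : rho < 1.
  rewrite /rho powR_expR// expR_lt1 mulNr oppr_lt0 mulr_gt0 ?ln_gt0 ?ltr1n//; lra.
have rhoge1 k : 1 <= rho ^- k.
  by rewrite invf_ge1 ?exprn_gt0// exprn_ile1// ltW.
have [C HC] := sum_cube_geometric (introT andP (conj rho0 rho1)).
have C0 : 0 <= C by apply: le_trans (HC 0%N); rewrite big_ord0.
(* Only c >= 89 is kept of the constant 864; 89 = 1 + 39 + 49 bounds the coefficient at v = 2. *)
have [c c89 Hc] : exists2 c : R, 89 <= c & forall p v r, (0 < p)%N -> 0 <= r ->
    r ^+ 2 = p%:R ^+ 3 -> `|residual_local R p v| <= c * v.+1%:R ^+ 3 * r ^+ v.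
  by exists 864; [rewrite ler_nat|exact: residual_local_le].
have c0 : 0 <= c by apply: le_trans c89; exact: ler0n.
(* For v >= 3, three factors y give y^3 = p^(-15/14) and the others are at most rho; rho^(-3)
   restores the full power rho^v. *)
pose A := c * rho ^- 3.
have A0 : 0 <= A by rewrite mulr_ge0// invr_ge0 exprn_ge0// ltW.
exists (A * C) => [|p J pr_p]; first exact: mulr_ge0.
have p0 := prime_gt0 pr_p; have p2 := prime_gt1 pr_p.
have P0 : 0 < p%:R :> R by rewrite ltr0n.
have P1 : 1 <= p%:R :> R by rewrite ler1n.
pose z : R := p%:R `^ (- (13 / 7)).
pose e : R := p%:R `^ (- 1 - 1 / 14).
have pD (b d : R) : p%:R `^ b * p%:R `^ d = p%:R `^ (b + d) :> R.
  by rewrite powRD//; apply/implyP => _; rewrite gt_eqF.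
have pX (b : R) k : (p%:R `^ b) ^+ k = p%:R `^ (b * k%:R) :> R.
  by rewrite powRrM powR_mulrn// powR_ge0.
have ple (b d : R) : b <= d -> p%:R `^ b <= p%:R `^ d :> R by move=> bd; rewrite ler_powR.
have z0 : 0 <= z by exact: powR_ge0.
have e0 : 0 <= e by exact: powR_ge0.
pose r : R := p%:R `^ (3 / 2).
have r2 : r ^+ 2 = p%:R ^+ 3.
  by rewrite pX -powR_mulrn ?(ltW P0)//; congr powR; lra.
pose y : R := p%:R `^ (- (5 / 14)).
have rz : r * z = y by rewrite pD; congr powR; lra.
have y0 : 0 <= y by exact: powR_ge0.
have y3 : y ^+ 3 = e by rewrite pX; congr powR; lra.
have yrho : y <= rho.
  rewrite /y /rho !powRN lef_pV2 ?posrE ?powR_gt0//.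
  by rewrite ge0_ler_powR ?nnegrE ?ler_nat//; lra.
(* The general bound would give only p^(-5/14) and p^(-5/7) at v = 1 and v = 2, so the exact
   coefficients are used there. *)
have term v : (0 < v)%N ->
    `|residual_local R p v| * z ^+ v <= A * (v.+1%:R ^+ 3 * rho ^+ v) * e.
  move=> v0; have [v3|] := leqP 3 v.
    have h := Hc _ v _ p0 (powR_ge0 _ _ : 0 <= r) r2.
    apply: (le_trans (ler_wpM2r (exprn_ge0 _ z0) h)).
    rewrite -(mulrA _ (r ^+ v)) -exprMn rz -(subnKC v3) !exprD y3 /A.
    set B := (_ : R) ^+ 3; set w := (v - 3)%N.
    have -> : c * rho ^- 3 * (B * (rho ^+ 3 * rho ^+ w)) * e = c * B * (e * rho ^+ w).
      by field; rewrite gt_eqF.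
    rewrite ler_wpM2l ?mulr_ge0 ?exprn_ge0// ler_wpM2l// lerXn2r ?nnegrE// ltW//.
  case: v v0 => [|[|[|]]]// _ _.
    rewrite residual_local1 !expr1 ger0_norm ?ler0n//.
    have ze : z <= e by apply: ple; lra.
    have -> : A * (2 ^+ 3 * rho) * e = c * (8 * rho ^- 2) * e.
      by rewrite /A; field; rewrite gt_eqF.
    have h := rhoge1 2%N; apply: ler_pM; [exact: ler0n|exact: z0| |exact: ze].
    by rewrite (le_trans (y := c))//; [lra | rewrite ler_peMr//; lra].
  rewrite residual_local2.
  have h : `|- p%:R ^+ 2 - 39 * p%:R + 49| <= 89 * p%:R ^+ 2 :> R.
    have pp : p%:R <= p%:R ^+ 2 :> R by rewrite expr2 ler_peMl// ltW.
    by rewrite ler_norml; apply/andP; split; lra.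
  apply: (le_trans (ler_wpM2r (exprn_ge0 _ z0) h)).
  have ze : p%:R ^+ 2 * z ^+ 2 <= e.
    by rewrite -powR_mulrn ?(ltW P0)// pX pD; apply: ple; lra.
  have -> : A * (3 ^+ 3 * rho ^+ 2) * e = c * (27 * rho ^- 1) * e.
    by rewrite /A; field; rewrite gt_eqF.
  have h1 := rhoge1 1%N; rewrite -(mulrA 89); apply: ler_pM; [exact: ler0n| | |exact: ze].
    by rewrite mulr_ge0 ?exprn_ge0 ?(ltW P0).
  by rewrite (le_trans c89)// ler_peMr//; lra.
rewrite big_ord_recl/= expr0 mulr1 residual_local0 normr1 lerD2l.
apply: (@le_trans _ _ (\sum_(v < J) A * (v.+2%:R ^+ 3 * rho ^+ v.+1) * e)).
  by apply: ler_sum => v _; exact: term.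
rewrite -mulr_suml ler_wpM2r// -mulr_sumr ler_wpM2l//.
apply: le_trans (HC J.+1); rewrite [leRHS]big_ord_recl/= lerDr.
by rewrite mulr_ge0 ?exprn_ge0// ltW.
Qed.

(** By 1 + t <= expR t the Euler product is at most the exponential of a convergent sum of
    p^(-15/14). *)
Lemma residual_summable : exists H : R, forall N,
  \sum_(1 <= n < N.+1) `|euler (residual_local R) n| * n%:R `^ (- (13 / 7)) <= H.
Proof.
have [C C0 HC] := residual_local_sum_le.
exists (expR (C * (1 + (1 / 14)^-1))) => N.
pose W p v := `|residual_local R p v| * (p%:R `^ (- (13 / 7))) ^+ v.
have W0 p v : 0 <= W p v by rewrite mulr_ge0// exprn_ge0// powR_ge0.
have W1 p : W p 0%N = 1 by rewrite /W residual_local0 normr1 expr0 mulr1.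
rewrite (eq_big_nat _ _ (F2 := euler W)) => [|n /andP[n0 _]]; last first.
  by apply: euler_norm_powR => // p; exact: residual_local0.
apply: le_trans (euler_sum_le N W0 W1) _.
apply: (@le_trans _ _ (\prod_(p < N.+1 | prime p) expR (C * p%:R `^ (- 1 - 1 / 14)))).
  apply: ler_prod => p pr_p; rewrite sumr_ge0//=.
  exact: le_trans (HC _ _ pr_p) (expR_ge1Dx _).
rewrite -expR_sum ler_expR -mulr_sumr ler_wpM2l//.
have d0 : 0 < 1 / 14 :> R by rewrite divr_gt0.
apply: le_trans (sum_powR_le N d0).
rewrite big_geq_mkord [leLHS]big_mkcond [leRHS]big_mkcond; apply: ler_sum => p _.
case: ifP => [/prime_gt0 ->//|_]; case: ifP => // _; exact: powR_ge0.
Qed.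

End ResidualBound.

(** * Assembling the expansion of T3 *)

Section Assembly.
Variable R : realType.
Implicit Types (x y : R).

Lemma conv_ge0 (a b : nat -> R) : (forall n, 0 <= a n) -> (forall n, 0 <= b n) ->
  forall n, 0 <= conv a b n.
Proof. by move=> a0 b0 n; apply: sumr_ge0 => d _; exact: mulr_ge0. Qed.

Lemma euler_ge0 (F : nat -> nat -> R) : (forall p v, 0 <= F p v) ->
  forall n, 0 <= euler F n.
Proof. by move=> F0 n; apply: prodr_ge0. Qed.

(* Writing the saving as al, a convolution of savings al and be achieves any
   saving below al be / (al + be): four factors 1 and one factor 1/2 would give
   1/6, which leaves room for the rounded values used here. *)
Lemma asym_principal : asym (principal R) 5 (1 / 8).
Proof.
pose nu n : R := n%:R.
have nu0 n : 0 <= nu n by exact: ler0n.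
have A1 : asym nu 1 1 by exact: asym_id.
have A2 : asym (conv nu nu) 2 (2 / 5).
  by apply: (@asym_conv _ _ _ 1 1 _ _ _ _ _ _ _ _ _ A1 A1) => //; lra.
have n2 := conv_ge0 nu0 nu0.
have A3 : asym (conv nu (conv nu nu)) 3 (1 / 4).
  by apply: (@asym_conv _ _ _ 1 2 _ _ _ _ _ _ _ _ _ A1 A2) => //; lra.
have n3 := conv_ge0 nu0 n2.
have A4 : asym (conv nu (conv nu (conv nu nu))) 4 (2 / 11).
  by apply: (@asym_conv _ _ _ 1 3 _ _ _ _ _ _ _ _ _ A1 A3) => //; lra.
have n4 := conv_ge0 nu0 n3.
have Aq : asym (euler (square_factor R)) 1 (1 / 2).
  by apply: asym_square_cube; [exact: euler_square|exact: euler_nonsquare].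
have q0 n : 0 <= euler (square_factor R) n.
  apply: euler_ge0 => p v; rewrite /square_factor /geom.
  by case: ifP => // _; rewrite exprn_ge0// exprn_ge0.
by apply: (@asym_conv _ _ _ 1 4 _ _ _ _ _ _ _ _ _ Aq A4) => //; lra.
Qed.

Lemma asym_cube_sum : asym (cube_sum R) 5 (1 / 8).
Proof.
have [H HH] := residual_summable R.
(* The condition on the weight is 1/8 + 13/7 = 111/56 < 2. *)
have [||P sP HP] := asym_conv_summable _ _ HH asym_principal; [lra|lra|].
exists P => //; apply: isO_eq HP => x x1; congr (_ - _).
by apply: eq_big_nat => n /andP[n0 _]; rewrite cube_sum_conv.
Qed.

(** Pairs are indexed by the cube root k of their product, which is unique, and m * n <= x becomes k
    <= x^(1/3). *)
Lemma T3_summatory x : 1 <= x -> T3 x = summatory (cube_sum R) (x `^ 3^-1).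
Proof.
move=> x1; have x0 : 0 <= x by apply: le_trans x1.
set y := x `^ 3^-1; pose X := Num.truncn x.
have y0 : 0 <= y by exact: powR_ge0.
have y3 : y ^+ 3 = x by rewrite /y -powR_mulrn ?powR_ge0// -powRrM mulVf// powRr1.
have yX : (Num.truncn y <= X)%N.
  rewrite le_truncn// /y -[leRHS]powRr1// ler_powR// invf_le1//.
  by rewrite ler1n.
have cubex k : ((k ^ 3)%:R <= x) = (k%:R <= y :> R).
  by rewrite natrX -y3 ler_pXn2r ?nnegrE.
rewrite (summatoryE _ y0 yX) /T3 -/X.
transitivity (\sum_(1 <= k < X.+1) \sum_(1 <= m < X.+1) \sum_(1 <= n < X.+1)
   if (k%:R <= y) && (m * n == k ^ 3)%N then (s m n)%:R else 0 : R); last first.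
  rewrite [RHS]big_mkcond [LHS]big_nat [RHS]big_nat; apply: eq_bigr => k /andP[k0 kX].
  case: ifP => ky /=; last by rewrite big1// => m _; rewrite big1.
  have k3X : (0 < k ^ 3 <= X)%N.
    by rewrite expn_gt0 k0/= truncn_ge_nat// cubex.
  rewrite /cube_sum (divisor_sumE (fun m n => (gcd_sum m n)%:R) k3X).
  apply: eq_big_nat => m /andP[m0 _]; rewrite -big_mkcond.
  rewrite [LHS]big_nat_cond [RHS]big_nat_cond.
  by apply: eq_bigr => n /andP[/andP[n0 _] _]; rewrite s_gcd_sum.
rewrite [RHS]exchange_big; apply: eq_big_nat => m /andP[m0 mX].
rewrite [RHS]exchange_big big_mkcond; apply: eq_big_nat => n /andP[n0 nX].
have mn0 : (0 < m * n)%N by rewrite muln_gt0 m0.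
rewrite -big_mkcond /perfect_cube; case: existsP => [[[k kb] /= /eqP kmn]|nocube].
  rewrite andbT -kmn cubex (eq_bigl (fun j => (j%:R <= y) && (j == k))) => [|j].
    rewrite (big_nat1_cond_eq _ _ (fun k => k%:R <= y)).
    case: (boolP (_ <= y)) => ky; last by rewrite andbF.
    rewrite andbT ifT// ltnS (leq_trans _ yX) ?truncn_ge_nat// andbT.
    by move: mn0; rewrite -{1}kmn expn_gt0 orbF.
  by rewrite eqn_exp2r// eq_sym.
rewrite andbF big1// => k /andP[_ /eqP mnk]; case: nocube.
have kb : (k < (m * n).+1)%N.
  rewrite ltnS mnk; case: k {mnk} => // k.
  by rewrite -[X in (X <= _)%N]expn1 leq_pexp2l.
by exists (Ordinal kb); rewrite /= mnk.
Qed.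

End Assembly.

Theorem theorem1p2 (R : realType) :
  exists a : 'I_5 -> R,
    forall eps : R, 0 < eps ->
      exists C : R,
        forall x : R, 1 <= x ->
          `|T3 x - x `^ (2 / 3) * \sum_(j < 5) a j * ln x ^+ j|
            <= C * x `^ (5 / 8 + eps).
Proof.
have [P sP /isO_ge0[C C0 HC]] := asym_cube_sum R.
(* The powers of 3 come from ln y = ln x / 3. *)
exists (fun j => P`_j / 3 ^+ j) => eps eps0; exists C => x x1.
have x0 : 0 < x by apply: lt_le_trans x1.
pose y := x `^ 3^-1.
have y1 : 1 <= y by rewrite powR_ge1// invr_ge0.
have -> : x `^ (2 / 3) = y ^+ 2.
  by rewrite /y -powR_mulrn ?powR_ge0// -powRrM; congr powR; lra.
have -> : \sum_(j < 5) P`_j / 3 ^+ j * ln x ^+ j = P.[ln y].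
  rewrite (horner_coef_wide _ sP); apply: eq_bigr => j _.
  by rewrite /y ln_powR exprMn exprVn mulrA.
rewrite (T3_summatory x1) (le_trans (HC _ y1))// ler_wpM2l// /y -powRrM ler_powR//.
lra.
Qed.
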